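(* Let $\mathcal{H}$ be a separable complex Hilbert space, let $A, B \in L(\mathcal{H})$ have closed range, let $C \in L(\mathcal{H})$ and let $W \in L(\mathcal{H})^{+}$ be such that $W^{1/2} \in S_p$ for some $p$ with $1 \leq p < \infty$ and $N(B)\subseteq N(A^*WC)$. Then the following are equivalent: \begin{enumerate} \item[i)] There exists $X_0 \in L(\mathcal{H})$ such that $\min_{X \in L(\mathcal{H})} \Vert AXB-C\Vert_{p,W}=\Vert AX_0B-C\Vert_{p,W}$. \item[ii)] The normal equation $A^{*}W(AXB-C)=0$ admits a solution $X\in L(\mathcal{H})$. \item[iii)] $R(C) \subseteq R(A)+R(A)^{\perp_{W}}$. \item[iv)] There exists $X_0 \in L(\mathcal{H})$ such that $$\min_{X \in L(\mathcal{H})} (AXB-C)^*W(AXB-C)=(AX_0B-C)^*W(AX_0B-C),$$ where the minimum is with respect to the order induced in $L(\mathcal{H})$ by the cone of positive operators. \end{enumerate} In this case, $$\min_{X \in L(\mathcal{H})} \Vert AXB-C\Vert_{p,W}=\Vert W_{/R(A)}^{1/2}C\Vert_p.$$ Moreover, in this case, $X_0 \in L(\mathcal{H})$ satisfies $\Vert AX_0B-C\Vert_{p,W}=\Vert W_{/R(A)}^{1/2}C\Vert_p$ if and only if $$X_0=(A^{*}WA)^{\dagger}A^{*}WCB^{\dagger}+L-(A^{*}WA)^{\dagger}A^{*}WALBB^{\dagger}$$ for some $L \in L(\mathcal{H})$.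
   Context: $L(\mathcal{H})$ is the algebra of bounded linear operators on $\mathcal{H}$ and $L(\mathcal{H})^{+}$ is the cone of positive semidefinite operators. $R(T)$ and $N(T)$ denote the range and the nullspace of $T$. Order: $S\le T$ if $T-S\in L(\mathcal{H})^{+}$. $T^{\dagger}$ denotes the Moore-Penrose inverse of $T\in L(\mathcal{H})$ (with domain $R(T)\oplus R(T)^{\perp}$; it is bounded and everywhere defined if and only if $R(T)$ is closed). For $1\le p<\infty$, $S_p$ is the $p$-Schatten class of compact operators $T$ on $\mathcal{H}$ with $\sum_k\lambda_k(T)^p<\infty$, where $\lambda_k(T)$ are the eigenvalues of $|T|=(T^*T)^{1/2}$ repeated according to multiplicity, and $\Vert T\Vert_p=(\sum_k\lambda_k(T)^p)^{1/p}$. When $W^{1/2}\in S_p$, $\Vert X\Vert_{p,W}=\Vert W^{1/2}X\Vert_p$ for $X\in L(\mathcal{H})$. For $\mathcal{S}\subseteq\mathcal{H}$, $\mathcal{S}^{\perp_W}=\{x\in\mathcal{H}:\langle Wx,y\rangle=0 \text{ for all } y\in \mathcal{S}\}=W^{-1}(\mathcal{S}^\perp)$. For a closed subspace $\mathcal{S}$, the shorted operator of $W$ to $\mathcal{S}$ is $W_{/\mathcal{S}}=\max \{ X \in L(\mathcal{H}): 0\leq X\leq W \mbox{ and } R(X)\subseteq \mathcal{S}^{\perp}\}$ (it is known that this maximum always exists), and $W_{/\mathcal{S}}^{1/2}=(W_{/\mathcal{S}})^{1/2}$. *)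

(* Defs.v *)
From HB Require Import structures.
From mathcomp Require Import all_boot all_order all_algebra.
From mathcomp Require Import all_classical all_reals all_analysis.
From mathcomp Require Import complex.

Set Implicit Arguments.
Unset Strict Implicit.
Unset Printing Implicit Defensive.

Import Order.TTheory GRing.Theory Num.Theory.
Import numFieldNormedType.Exports.

Local Open Scope classical_set_scope.
Local Open Scope complex_scope.
Local Open Scope ring_scope.

Section Extrema.
Context {T : Type}.
Implicit Types (le : T -> T -> Prop) (E : set T) (m : T).

(* Attained extrema: [m] must itself belong to [E]. *)
Definition is_min le E m := E m /\ forall x, E x -> le m x.
Definition is_max le E m := E m /\ forall x, E x -> le x m.

End Extrema.

(* A complex Hilbert space is a complete normed module [H] over [R[i]] with an
   inner product [dot] inducing its norm, see [hilbert_norm]; [dot] is linear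
   in its first argument and conjugate-linear in its second.  Operators are
   plain functions [H -> H], and membership in L(H) is the predicate
   [bounded_op]. *)
Section Operators.
Context {R : realType} {H : completeNormedModType R[i]}.
Variable dot : {dot H for Num.conj}.
Implicit Types (S T W X : H -> H) (M : set H) (p : R).

Definition hilbert_norm := forall x : H, `|x| ^+ 2 = dot x x.

Definition bounded_op T :=
  linear T /\ exists k : R[i], forall x, `|T x| <= k * `|x|.

Definition nullspace T : set H := [set x | T x = 0].

Definition perp M : set H := [set x | forall y, M y -> dot x y = 0].

Definition wperp W M : set H := [set x | forall y, M y -> dot (W x) y = 0].

Definition set_add (M N : set H) : set H := [set u + v | u in M & v in N].

(* The order of [R[i]] makes [0 <= z] entail that [z] is real. *)
Definition pos_op T := bounded_op T /\ forall x, 0 <= dot (T x) x.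

Definition op_le S T := pos_op (T \- S).

(* The adjoint, the positive square root and the shorted operator are unique
   when they exist; the default value 0 of [xget] is taken only on arguments
   for which they do not exist. *)
Definition adjoint T : H -> H :=
  xget (fun=> 0) [set S | bounded_op S /\
                          forall x y, dot (T x) y = dot x (S y)].

Definition op_sqrt T : H -> H :=
  xget (fun=> 0) [set S | pos_op S /\ S \o S = T].

Definition op_abs T : H -> H := op_sqrt (adjoint T \o T).

Definition shorted W M : H -> H :=
  xget (fun=> 0)
    [set X | is_max op_le
       [set Y | [/\ bounded_op Y, op_le (fun=> 0) Y, op_le Y W &
                    range Y `<=` perp M]] X].

(* The Moore-Penrose inverse is in general a partial operator, with domain
   R(T) + R(T)^perp; it sends T x + v to x for x in N(T)^perp and v in
   R(T)^perp.  [mp_inv T] takes the value 0 outside [mp_dom T]. *)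
Definition mp_dom T : set H := set_add (range T) (perp (range T)).

Definition mp_inv T (y : H) : H :=
  xget 0 [set x | perp (nullspace T) x /\
                  exists2 v, perp (range T) v & y = T x + v].

Definition compact_op T :=
  bounded_op T /\ compact (closure (T @` [set x | `|x| <= 1])).

Definition lin_indep n (e : 'I_n -> H) :=
  forall c : 'I_n -> R[i], \sum_(i < n) c i *: e i = 0 -> forall i, c i = 0.

(* dim N(T - l), possibly infinite; 0 if [l] is not an eigenvalue of [T]. *)
Definition multiplicity T (l : R) : \bar R :=
  ereal_sup [set (n%:R)%:E | n in
    [set n : nat | exists e : 'I_n -> H,
       lin_indep e /\ forall i, T (e i) = l%:C *: e i]].

(* The sum of lambda_k(T)^p over the eigenvalues of |T| repeated according to
   multiplicity, with equal eigenvalues grouped.  The eigenvalues of |T| are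
   nonnegative reals, and 0 does not contribute. *)
Definition schatten_sum p T : \bar R :=
  (\esum_(l in [set l : R | (0 < l)%R])
     (multiplicity (op_abs T) l * (l `^ p)%:E))%E.

Definition schatten_class p T := compact_op T /\ (schatten_sum p T < +oo)%E.

(* Meaningful, and then finite, for [T] in [schatten_class p]. *)
Definition schatten_norm p T : \bar R := poweR (schatten_sum p T) p^-1.

Definition wschatten_norm p W X : \bar R := schatten_norm p (op_sqrt W \o X).

End Operators.

(* Main.v *)
(* Write V = W^{1/2} and T(X) = V (A X B - C). No differentiation of the Schatten
   norm is needed: if T = T(X0) does not satisfy the normal equation, then
   T' = (1 - e V A A^* V) T is again of the form T(X), because N(B) is contained in
   N(A^* W C) and B has closed range, and |T' h| <= |T h| for every h, strictly for
   some h. Min-max gives s_n(T') <= s_n(T), and Ky Fan's inequality shows that the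
   singular values, hence the (finite) Schatten sums, cannot all be equal.
   Conversely the normal equation makes T(X0) orthogonal to V A, so X0 is minimal
   for the operator order, and therefore for the norm, with T(X0) = -(1 - P) V C, P the
   projection on the closure of R(V A); the shorted operator is V (1 - P) V.
   Condition iii) says R(A^* W C) is contained in R(A^* W A), which gives a bounded
   solution by a Douglas-type factorization, obtained here from uniform boundedness. *)

Require Import Defs.
From HB Require Import structures.
From mathcomp Require Import all_boot all_order all_algebra.
From mathcomp Require Import all_classical all_reals all_analysis.
From mathcomp Require Import complex.
From mathcomp Require Import ring lra.

Set Implicit Arguments.
Unset Strict Implicit.
Unset Printing Implicit Defensive.

Import Order.TTheory GRing.Theory Num.Theory.
Import numFieldNormedType.Exports.

Local Open Scope classical_set_scope.
Local Open Scope complex_scope.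
Local Open Scope ring_scope.

(** * Inner products and bounded operators *)

Section InnerProduct.
Context {R : realType} {H : completeNormedModType R[i]}.
Variable dot : {dot H for Num.conj}.
Implicit Types (x y z : H) (a : R) (c : R[i]).

(** Every comparison goes through the quadratic form [hnormsq (T x)]: it determines [T^* T], hence
    the absolute value and the Schatten sum, so operator inequalities become inequalities between
    reals, and working with the real part of [dot] mostly avoids the partially ordered field R[i].
    One obstacle is that the Schatten sum is defined by eigenvalue multiplicities, while comparisons
    need ordered singular values; [svd] packages a sequence of right singular vectors, padded with
    zeros when the rank is finite, and [schatten_sum_svd] regroups its terms by value. Another is
    that monotone singular values alone do not exclude a tie between two different forms.
    [svd_rigidity] excludes it, using that singular values tend to 0, while finiteness of the sum
    permits termwise cancellation. Finally, the range of [A^* W A] need not be closed, so its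
    generalized inverse may be unbounded; only its composite with [A^* W C] is bounded. *)

Definition redot x y : R := complex.Re (dot x y).
Definition hnormsq x : R := redot x x.
Definition hnorm x : R := Num.sqrt (hnormsq x).

Lemma dotC x y : dot x y = (dot y x)^*%C.
Proof. by rewrite hermC expr0 mul1r. Qed.

Lemma rdotC x y : redot x y = redot y x.
Proof. by rewrite /redot dotC; case: (dot y x). Qed.

Lemma ReD c1 c2 : complex.Re (c1 + c2) = complex.Re c1 + complex.Re c2 :> R.
Proof. by case: c1 => a b; case: c2 => d e. Qed.

Lemma ReN c : complex.Re (- c) = - complex.Re c :> R.
Proof. by case: c => a b. Qed.

Lemma rdotDl x y z : redot (x + y) z = redot x z + redot y z.
Proof. by rewrite /redot linearDl ReD. Qed.
Lemma rdotDr x y z : redot z (x + y) = redot z x + redot z y.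
Proof. by rewrite /redot linearDr ReD. Qed.
Lemma rdotNl x z : redot (- x) z = - redot x z.
Proof. by rewrite /redot linearNl ReN. Qed.
Lemma rdotNr x z : redot z (- x) = - redot z x.
Proof. by rewrite rdotC rdotNl rdotC. Qed.
Lemma rdotBl x y z : redot (x - y) z = redot x z - redot y z.
Proof. by rewrite rdotDl rdotNl. Qed.
Lemma rdotBr x y z : redot z (x - y) = redot z x - redot z y.
Proof. by rewrite rdotDr rdotNr. Qed.
Lemma rdot0l z : redot 0 z = 0. Proof. by rewrite /redot linear0l. Qed.
Lemma rdot0r z : redot z 0 = 0. Proof. by rewrite rdotC rdot0l. Qed.
Lemma dotZl c x y : dot (c *: x) y = c * dot x y.
Proof. by rewrite linearZl_LR. Qed.
Lemma dotZr c x y : dot x (c *: y) = c^*%C * dot x y.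
Proof. by rewrite linearZr_LR. Qed.
Lemma rdotZl a x y : redot (a%:C *: x) y = a * redot x y.
Proof. by rewrite /redot dotZl; case: (dot x y) => b d /=; rewrite mul0r subr0. Qed.
Lemma rdotZr a x y : redot x (a%:C *: y) = a * redot x y.
Proof. by rewrite rdotC rdotZl rdotC. Qed.
Lemma rdot_ir x y : redot x ('i *: y) = complex.Im (dot x y).
Proof.
rewrite /redot dotZr; case: (dot x y) => b d /=.
by ring.
Qed.

Lemma dot_nsq x : dot x x = (hnormsq x)%:C.
Proof. by rewrite /hnormsq /redot RRe_real// ger0_real// dnorm_ge0. Qed.

Lemma nsq_ge0 x : 0 <= hnormsq x.
Proof. by rewrite -lecR -dot_nsq dnorm_ge0. Qed.

Lemma nsq_eq0 x : (hnormsq x == 0) = (x == 0).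
Proof. by rewrite -(dnorm_eq0 dot) dot_nsq -(inj_eq (@complexI R)). Qed.

Lemma nsqD x y : hnormsq (x + y) = hnormsq x + 2 * redot x y + hnormsq y.
Proof. rewrite /hnormsq rdotDl !rdotDr (rdotC y x); ring. Qed.
Lemma nsqN x : hnormsq (- x) = hnormsq x.
Proof. by rewrite /hnormsq rdotNl rdotNr opprK. Qed.
Lemma nsqB x y : hnormsq (x - y) = hnormsq x - 2 * redot x y + hnormsq y.
Proof. by rewrite nsqD nsqN rdotNr; ring. Qed.
Lemma nsqZ a x : hnormsq (a%:C *: x) = a ^+ 2 * hnormsq x.
Proof. by rewrite /hnormsq rdotZl rdotZr; ring. Qed.
Lemma nsqZc c x : (hnormsq (c *: x))%:C = `|c| ^+ 2 * (hnormsq x)%:C.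
Proof. by rewrite -!dot_nsq dnormZ. Qed.
Lemma nsqi x : hnormsq ('i *: x) = hnormsq x.
Proof.
apply: complexI; rewrite nsqZc normc_def /= expr0n /= expr1n add0r sqrtr1.
by rewrite expr1n mul1r.
Qed.
Lemma nsq0 : hnormsq 0 = 0. Proof. exact: rdot0l. Qed.

Lemma rdot_sqr_le x y : redot x y ^+ 2 <= hnormsq x * hnormsq y.
Proof.
have [/eqP|y0] := boolP (hnormsq y == 0).
  move=> y0; move: (y0) => /eqP; rewrite nsq_eq0 => /eqP ->.
  by rewrite rdot0r expr0n nsq0 mulr0.
have yp : 0 < hnormsq y by rewrite lt_def y0 nsq_ge0.
(* The component of [x] orthogonal to [y], scaled by [hnormsq y] to avoid a division. *)
have := nsq_ge0 ((hnormsq y)%:C *: x - (redot x y)%:C *: y).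
rewrite nsqB !nsqZ rdotZl rdotZr => h.
have : 0 <= hnormsq y * (hnormsq x * hnormsq y - redot x y ^+ 2) by nra.
by rewrite pmulr_rge0// subr_ge0.
Qed.

Lemma nm_ge0 x : 0 <= hnorm x. Proof. exact: sqrtr_ge0. Qed.
Lemma sqr_nm x : hnorm x ^+ 2 = hnormsq x. Proof. by rewrite sqr_sqrtr// nsq_ge0. Qed.
Lemma nm_eq0 x : (hnorm x == 0) = (x == 0).
Proof. by rewrite -nsq_eq0 -sqr_nm sqrf_eq0. Qed.
Lemma nm0 : hnorm 0 = 0. Proof. by apply/eqP; rewrite nm_eq0. Qed.
Lemma nm_gt0 x : (0 < hnorm x) = (x != 0).
Proof. by rewrite lt_def nm_eq0 nm_ge0 andbT. Qed.
Lemma nmN x : hnorm (- x) = hnorm x. Proof. by rewrite /hnorm nsqN. Qed.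
Lemma nmBC x y : hnorm (x - y) = hnorm (y - x). Proof. by rewrite -nmN opprB. Qed.
Lemma nmZ a x : hnorm (a%:C *: x) = `|a| * hnorm x.
Proof. by rewrite /hnorm nsqZ sqrtrM ?sqr_ge0// sqrtr_sqr. Qed.
Lemma nmi x : hnorm ('i *: x) = hnorm x. Proof. by rewrite /hnorm nsqi. Qed.
Lemma le_nm x y : (hnorm x <= hnorm y) = (hnormsq x <= hnormsq y).
Proof. by rewrite -!sqr_nm ler_sqr// nnegrE nm_ge0. Qed.

Lemma rdot_le x y : `|redot x y| <= hnorm x * hnorm y.
Proof.
rewrite -ler_sqr ?nnegrE ?mulr_ge0 ?nm_ge0// real_normK ?num_real//.
by rewrite exprMn !sqr_nm rdot_sqr_le.
Qed.

Lemma nm_triangle x y : hnorm (x + y) <= hnorm x + hnorm y.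
Proof.
rewrite -ler_sqr ?nnegrE ?addr_ge0 ?nm_ge0// sqr_nm nsqD sqrrD !sqr_nm.
have := le_trans (ler_norm _) (rdot_le x y); lra.
Qed.
Lemma nm_dist x y z : hnorm (x - z) <= hnorm (x - y) + hnorm (y - z).
Proof. by rewrite -[x - z](subrKA y) nm_triangle. Qed.

Lemma rdot_inj x y : (forall z, redot x z = redot y z) -> x = y.
Proof.
move=> h; apply/eqP; rewrite -subr_eq0 -nsq_eq0 /hnormsq rdotBl.
by rewrite h subrr.
Qed.

Lemma dotDl x y z : dot (x + y) z = dot x z + dot y z.
Proof. exact: linearDl. Qed.
Lemma dotNl x z : dot (- x) z = - dot x z.
Proof. exact: linearNl. Qed.
Lemma dot0l z : dot 0 z = 0.
Proof. exact: linear0l. Qed.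
Lemma dot_injl x y : (forall z, dot x z = dot y z) -> x = y.
Proof. by move=> h; apply: rdot_inj => z; rewrite /redot h. Qed.

Lemma dot_injr x y : (forall z, dot z x = dot z y) -> x = y.
Proof. by move=> h; apply: rdot_inj => z; rewrite rdotC /redot h -[RHS]rdotC. Qed.

End InnerProduct.

(* Identities between vectors are checked after pairing with a test vector,
   where they become ring identities between scalars. *)
Ltac vector_ring dot :=
  apply: (@dot_injl _ _ dot) => ?;
  rewrite ?(dotDl, dotNl, dotZl, dot0l); ring.

Section Norm.
Context {R : realType} {H : completeNormedModType R[i]}.
Variable dot : {dot H for Num.conj}.
Hypothesis Hnorm : hilbert_norm dot.
Local Notation nm := (hnorm dot).
Local Notation nsq := (hnormsq dot).
Implicit Types (x y z : H) (M : set H).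

Lemma norm_nm x : `|x| = (nm x)%:C.
Proof.
apply: (pexpIrn (n := 2)) => //; rewrite ?nnegrE ?normr_ge0 ?ler0c ?nm_ge0//.
by rewrite Hnorm dot_nsq -sqr_nm rmorphXn.
Qed.

Lemma nmZc (c : R[i]) x : nm (c *: x) = complex.Re `|c| * nm x.
Proof.
have : `|c *: x| = `|c| * `|x| by rewrite normrZ.
rewrite !norm_nm => /(congr1 (@complex.Re R)) /=; case: `|c| => u v /=.
by rewrite mulr0 subr0.
Qed.

Lemma ball_nm x y (e : R) : ball x e%:C y = (nm (x - y) < e) :> Prop.
Proof. by rewrite -ball_normE /ball_ /= norm_nm ltcR. Qed.

Lemma nbhs_nm x (B : set H) :
  nbhs x B <-> exists2 e : R, 0 < e & forall y, nm (x - y) < e -> B y.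
Proof.
split => [/nbhs_ballP[e /= e0 h]|[e e0 h]].
  move: (e0); rewrite ltcE /= => /andP[/eqP ie re].
  exists (complex.Re e) => // y hy; apply: h.
  have -> : e = (complex.Re e)%:C by rewrite RRe_real// gtr0_real.
  by rewrite ball_nm.
apply/nbhs_ballP; exists e%:C; first by rewrite /= ltcR.
by move=> y; rewrite ball_nm => /h.
Qed.

Lemma closure_nm M x :
  closure M x <-> forall e, 0 < e -> exists2 y, M y & nm (x - y) < e.
Proof.
split=> [h e e0|h B /nbhs_nm[e e0 hB]].
  have /h[y [My ye]] : nbhs x [set y | nm (x - y) < e].
    by apply/nbhs_nm; exists e.
  by exists y.
by have [y My ye] := h e e0; exists y; split => //; exact: hB.
Qed.

(** The explicit rate [b] survives in the limit; linearity and fixed-point equations are later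
    carried to [l] through it. *)
Lemma complete_nm (u : nat -> H) (b : nat -> R) :
  (forall e, 0 < e -> exists n, b n < e) ->
  (forall n m, (n <= m)%N -> nm (u m - u n) <= b n) ->
  exists l, forall n, nm (l - u n) <= b n.
Proof.
move=> b0 ub.
(* Balls have radii in R[i], whose positive elements are real. *)
have real_ball e : 0 < e -> exists2 r : R, 0 < r & e = r%:C :> R[i].
  move=> e0; move: (e0); rewrite ltcE /= => /andP[_ re].
  by exists (complex.Re e) => //; rewrite RRe_real// gtr0_real.
have /cauchy_cvgP cu : cauchy (u @ \oo).
  apply: cauchy_exP => e /real_ball[r r0 ->{e}].
  have [n bn] := b0 _ r0; exists (u n), n => // m /= nm; rewrite ball_nm nmBC.
  exact: le_lt_trans (ub _ _ nm) bn.
exists (lim (u @ \oo)) => n; apply/ler_addgt0Pr => e e0.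
have : \forall m \near \oo, ball (lim (u @ \oo)) e%:C (u m).
  by apply: (cvg_ball cu); rewrite ltcR.
move=> [m _ hm].
have := hm (maxn m n) (leq_maxl _ _); rewrite ball_nm => h1.
have h2 := ub _ _ (leq_maxr m n).
apply: le_trans (nm_dist dot _ (u (maxn m n)) _) _; rewrite addrC.
by rewrite lerD// ltW.
Qed.

Lemma bounded_opP (T : H -> H) : bounded_op T <->
  linear T /\ exists2 k : R, 0 <= k & forall x, nm (T x) <= k * nm x.
Proof.
split=> -[lT] => [[k hk]|[k k0 hk]]; split => //.
  exists `|complex.Re k| => // x; have := hk x.
  rewrite !norm_nm lecE => /andP[_] /=; case: (k) => a b /=.
  rewrite mulr0 subr0 => /le_trans; apply.
  by rewrite ler_wpM2r ?nm_ge0// ler_norm.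
by exists k%:C => x; rewrite !norm_nm -rmorphM lecR.
Qed.

Lemma bop_linear (T : H -> H) : bounded_op T -> linear T.
Proof. by case. Qed.

Lemma bop_bound (T : H -> H) : bounded_op T ->
  exists2 k : R, 0 <= k & forall x, nm (T x) <= k * nm x.
Proof. by case/bounded_opP. Qed.

Lemma linD (T : H -> H) : linear T -> {morph T : x y / x + y}.
Proof. by move=> lT x y; have := lT 1 x y; rewrite !scale1r. Qed.
Lemma lin0 (T : H -> H) : linear T -> T 0 = 0.
Proof. by move=> lT; apply/eqP; rewrite -(inj_eq (addrI (T 0))) -(linD lT) !addr0. Qed.
Lemma linZ (T : H -> H) : linear T -> forall c x, T (c *: x) = c *: T x.
Proof. by move=> lT c x; have := lT c x 0; rewrite (lin0 lT) !addr0. Qed.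
Lemma linN (T : H -> H) : linear T -> {morph T : x / - x}.
Proof. by move=> lT x; rewrite -scaleN1r (linZ lT) scaleN1r. Qed.
Lemma linB (T : H -> H) : linear T -> {morph T : x y / x - y}.
Proof. by move=> lT x y; rewrite (linD lT) linN. Qed.
Lemma lin_sum (T : H -> H) n (F : 'I_n -> H) : linear T ->
  T (\sum_(i < n) F i) = \sum_(i < n) T (F i).
Proof. by move=> lT; apply: (big_morph T); [exact: linD|exact: lin0]. Qed.

Lemma bop_id : bounded_op (@id H).
Proof. by apply/bounded_opP; split=> //; exists 1 => // x; rewrite mul1r. Qed.

Lemma bop_comp (S T : H -> H) : bounded_op S -> bounded_op T -> bounded_op (S \o T).
Proof.
move=> /bounded_opP[lS [k k0 hk]] /bounded_opP[lT [l l0 hl]].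
apply/bounded_opP; split; first by move=> a x y /=; rewrite lT lS.
exists (k * l) => [|x]; first exact: mulr_ge0.
by rewrite /= (le_trans (hk _))// -mulrA ler_wpM2l.
Qed.

Lemma bop_scale (c : R[i]) (T : H -> H) : bounded_op T -> bounded_op (fun x => c *: T x).
Proof.
move=> [lT [k hk]]; split; first by move=> a x y /=; rewrite lT scalerDr !scalerA mulrC.
by exists (`|c| * k) => x; rewrite normrZ -mulrA ler_wpM2l.
Qed.

Lemma bop_add (S T : H -> H) : bounded_op S -> bounded_op T -> bounded_op (S \+ T).
Proof.
move=> [lS [k hk]] [lT [l hl]]; split.
  by move=> a x y /=; rewrite lT lS scalerDr addrACA.
by exists (k + l) => x; rewrite mulrDl (le_trans (ler_normD _ _))// lerD.
Qed.

Lemma bop_sub (S T : H -> H) : bounded_op S -> bounded_op T -> bounded_op (S \- T).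
Proof.
move=> bS /(bop_scale (-1)) /(bop_add bS).
by congr bounded_op; apply/funext => x /=; rewrite scaleN1r.
Qed.

Lemma bop0 : bounded_op (fun _ : H => 0 : H).
Proof.
by apply/bounded_opP; split=> [a x y|]; rewrite ?scaler0 ?addr0//; exists 0 => // x; rewrite nm0 mul0r.
Qed.

End Norm.

(** * Orthogonal projections and adjoints *)

Section Projection.
Context {R : realType} {H : completeNormedModType R[i]}.
Variable dot : {dot H for Num.conj}.
Hypothesis Hnorm : hilbert_norm dot.
Local Notation nm := (hnorm dot).
Local Notation nsq := (hnormsq dot).
Local Notation rdot := (redot dot).
Implicit Types (x y z : H) (M : set H) (T : H -> H).

Lemma small_eq0 (r K : R) : (forall e, 0 < e -> `|r| <= e * K) -> r = 0.
Proof.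
move=> h; apply/eqP; rewrite -normr_le0; apply/ler_addgt0Pr => e e0; rewrite add0r.
have K1 : 0 < `|K| + 1 by rewrite ltr_wpDl.
apply: le_trans (h _ (divr_gt0 e0 K1)) _.
by rewrite mulrAC ler_pdivrMr// ler_pM2l// (le_trans (ler_norm _))// lerDl.
Qed.

Lemma ex_invS_lt (r : R) : 0 < r -> exists n : nat, n.+1%:R^-1 < r.
Proof.
by move=> r0; have [n _ h] := near_infty_natSinv_lt (PosNum r0); exists n; apply: (h n (leqnn n)).
Qed.

(** Pairing with ['i *: y] recovers the imaginary part, so complex orthogonality is two real
    conditions. *)
Lemma dot_eq0_rdot x y : (dot x y = 0) <-> (rdot x y = 0 /\ rdot x ('i *: y) = 0).
Proof.
split; first by move=> d0; rewrite rdot_ir /rdot d0.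
by rewrite rdot_ir /rdot; case: (dot x y) => a b /= [-> ->].
Qed.

(** The operator [T] is present so that one lemma serves both orthogonal complements ([T] the
    identity) and kernels. *)
Lemma closure_dot T M y : bounded_op T -> (forall m, M m -> dot (T m) y = 0) ->
  forall x, closure M x -> dot (T x) y = 0.
Proof.
move=> /(bounded_opP Hnorm)[lT [k k0 hk]] hM x /(closure_nm Hnorm) cx.
suff h w : (forall m, M m -> rdot (T m) w = 0) -> rdot (T x) w = 0.
  by apply/dot_eq0_rdot; split; apply: h => m /hM /dot_eq0_rdot[].
move=> hw; apply: (@small_eq0 _ (k * nm w)) => e e0.
have [m Mm xm] := cx _ e0.
have -> : rdot (T x) w = rdot (T (x - m)) w by rewrite (linB lT) rdotBl (hw m)// subr0.
rewrite (le_trans (rdot_le _ _ _))// mulrA ler_wpM2r ?nm_ge0//.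
by rewrite (le_trans (hk _))// mulrC ler_wpM2r// ltW.
Qed.

Definition subspace M := M 0 /\ forall (a : R[i]) x y, M x -> M y -> M (a *: x + y).

Lemma subspaceD M x y : subspace M -> M x -> M y -> M (x + y).
Proof. by move=> [_ h] Mx My; have := h 1 _ _ Mx My; rewrite scale1r. Qed.
Lemma subspaceZ M a x : subspace M -> M x -> M (a *: x).
Proof. by move=> [h0 h] Mx; rewrite -[_ *: _]addr0; apply: h. Qed.
Lemma subspaceB M x y : subspace M -> M x -> M y -> M (x - y).
Proof. by move=> sM Mx My; apply: subspaceD => //; rewrite -scaleN1r; apply: subspaceZ. Qed.

Lemma subspace_closure M : subspace M -> subspace (closure M).
Proof.
move=> sM; split; first by apply: subset_closure; case: sM.
move=> a x y /(closure_nm Hnorm) cx /(closure_nm Hnorm) cy; apply/(closure_nm Hnorm) => e e0.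
have a1 : 0 < 2 * (`|complex.Re `|a| | + 1) by rewrite mulr_gt0// ltr_wpDl.
have [m Mm xm] := cx _ (divr_gt0 e0 a1).
have [n Mn yn] := cy _ (divr_gt0 e0 (ltr0n R 2)).
exists (a *: m + n); first by case: sM => _; apply.
rewrite opprD addrACA -scalerBr (le_lt_trans (nm_triangle _ _ _))// [ltRHS](splitr e).
have nmZa : nm (a *: (x - m)) <= `|complex.Re `|a| | * nm (x - m).
  by rewrite (nmZc Hnorm) ler_wpM2r ?nm_ge0// ler_norm.
apply: ler_ltD yn; apply: le_trans nmZa _.
have := xm; rewrite ltr_pdivlMr// => h.
rewrite ler_pdivlMr// mulrC mulrA; apply: le_trans (ltW h).
by rewrite mulrC ler_wpM2l ?nm_ge0// ler_wpM2l// lerDl.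
Qed.

(** Best approximation by a minimizing sequence. [M] is not assumed closed, so the point found lies
    only in its closure. *)
Lemma projection_point M x : subspace M ->
  exists p, closure M p /\ forall m, M m -> dot (x - p) m = 0.
Proof.
move=> sM; pose D : set R := [set nsq (x - m) | m in M].
have D0 : D !=set0 by exists (nsq (x - 0)), 0 => //; case: sM.
have lD : has_lbound D by exists 0 => _ [m _ <-]; exact: nsq_ge0.
pose d := inf D; pose e (n : nat) : R := n.+1%:R^-1.
have e_gt0 n : 0 < e n by rewrite invr_gt0.
have dle m : M m -> d <= nsq (x - m) by move=> Mm; apply: ge_inf => //; exists m.
(* With tolerance [e n ^+ 2 / 4] the parallelogram law bounds [nsq (u m - u n)] by
   [(e m ^+ 2 + e n ^+ 2) / 2 <= e n ^+ 2]. *)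
have /choice[u hu] n : exists m, M m /\ nsq (x - m) < d + e n ^+ 2 / 4.
  have [//|_ [m Mm <-] h] := @inf_adherent _ D (e n ^+ 2 / 4) _ (conj D0 lD).
    by rewrite divr_gt0// exprn_gt0.
  by exists m.
have le_e n m : (n <= m)%N -> e m <= e n by move=> nm; rewrite lef_pV2 ?posrE// ler_nat.
have [|n m nm|p hp] := @complete_nm _ _ dot Hnorm u e.
- exact: ex_invS_lt.
- rewrite -ler_sqr ?nnegrE ?nm_ge0 ?(ltW (e_gt0 _))// sqr_nm.
  have hm := dle _ (subspaceZ (2^-1)%:C sM (subspaceD sM (hu n).1 (hu m).1)).
  have -> : nsq (u m - u n) = 2 * nsq (x - u m) + 2 * nsq (x - u n)
      - 4 * nsq (x - (2^-1)%:C *: (u n + u m)).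
    rewrite !nsqB nsqZ rdotZr nsqD rdotDr (rdotC _ (u m) (u n)); by field.
  have := (hu n).2; have := (hu m).2.
  have : e m ^+ 2 <= e n ^+ 2 by rewrite ler_sqr ?nnegrE ?(ltW (e_gt0 _))// le_e.
  lra.
exists p; split.
  apply/(closure_nm Hnorm) => r r0.
  have [n hn] := ex_invS_lt r0.
  by exists (u n); [case: (hu n)|exact: le_lt_trans (hp n) hn].
suff h m : M m -> rdot (x - p) m = 0.
  move=> m Mm; apply/dot_eq0_rdot; split; apply: h => //.
  exact: subspaceZ.
move=> Mm; apply: (@small_eq0 _ (2 * nm m)) => r r0.
have [n hn] := ex_invS_lt r0.
have [m0|m0] := eqVneq m 0; first by rewrite m0 rdot0r normr0 nm0 !mulr0.
have q0 : 0 < nsq m by rewrite lt_def nsq_eq0 m0 nsq_ge0.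
set s := rdot (x - u n) m.
(* Minimality is tested at the optimal step [s / nsq m] along [m]. Orthogonality is approximate at
   [u n] and becomes exact at [p] in the limit. *)
have h1 : `|s| <= e n * nm m.
  have := dle _ (subspaceD sM (hu n).1 (subspaceZ (s / nsq m)%:C sM Mm)).
  rewrite opprD addrA [in leRHS]nsqB rdotZr nsqZ -/s.
  have := (hu n).2 => h2 h3.
  rewrite -ler_sqr ?nnegrE ?mulr_ge0 ?nm_ge0 ?(ltW (e_gt0 _))//.
  rewrite real_normK ?num_real// exprMn sqr_nm -ler_pdivrMr//.
  have E : 2 * (s / nsq m * s) = 2 * (s ^+ 2 / nsq m) by ring.
  have E2 : (s / nsq m) ^+ 2 * nsq m = s ^+ 2 / nsq m by field; rewrite gt_eqF.
  rewrite E E2 in h3; have := sqr_ge0 (e n); lra.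
have -> : rdot (x - p) m = s - rdot (p - u n) m by rewrite /s !rdotBl; ring.
have h2 : `|rdot (p - u n) m| <= e n * nm m.
  by rewrite (le_trans (rdot_le _ _ _))// ler_wpM2r ?nm_ge0.
rewrite (le_trans (ler_normB _ _))// (le_trans (lerD h1 h2))//.
by have := ler_wpM2r (nm_ge0 dot m) (ltW hn); rewrite -/(e n); lra.
Qed.

Lemma projection M : subspace M ->
  exists2 P : H -> H, bounded_op P &
    (forall x, closure M (P x)) /\ (forall x m, closure M m -> dot (x - P x) m = 0).
Proof.
move=> sM; have /choice[P hP] x := projection_point x sM.
have oP x m : closure M m -> dot (x - P x) m = 0.
  move=> cm; rewrite dotC.
  rewrite (@closure_dot id M (x - P x))//; [exact: rmorph0|exact: bop_id|].
  by move=> y My; rewrite dotC (hP x).2// rmorph0.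
have cP x : closure M (P x) by case: (hP x).
have sC := subspace_closure sM.
exists P; last by [].
apply/(bounded_opP Hnorm); split => [a x y|].
  apply/eqP; rewrite -subr_eq0 -(nsq_eq0 dot); apply/eqP; apply: complexI; rewrite -dot_nsq.
  (* The defect of linearity lies in the closure of [M] and, by [wE], is also orthogonal to it. *)
  set w := P _ - _.
  have cw : closure M w by apply: (subspaceB sC (cP _)); apply: sC.2; exact: cP.
  have wE : w = a *: (x - P x) + (y - P y) - ((a *: x + y) - P (a *: x + y)).
    by rewrite /w scalerBr addrACA -opprD opprB [RHS]addrC addrA subrK.
  by rewrite {1}wE linearBl/= linearDl/= dotZl !oP// mulr0 addr0 subr0.
exists 1 => // x; rewrite mul1r le_nm.
have -> : nsq x = nsq (x - P x) + nsq (P x).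
  rewrite -[in LHS](subrK (P x) x) (nsqD _ (x - P x)).
  have -> : rdot (x - P x) (P x) = 0 by rewrite /redot oP.
  by rewrite mulr0 addr0.
by rewrite lerDr nsq_ge0.
Qed.

(** Riesz representation of the functional sending [x] to [dot (T x) y]: a vector [z] normal to its
    kernel represents it after scaling. *)
Lemma adjoint_exists T : bounded_op T ->
  exists S, bounded_op S /\ forall x y, dot (T x) y = dot x (S y).
Proof.
move=> bT; have lT := bop_linear bT.
have /choice[S hS] y : exists v, forall x, dot (T x) y = dot x v.
  pose M := [set x | dot (T x) y = 0].
  have sM : subspace M.
    split=> [|a u v]; rewrite /M /=; first by rewrite (lin0 lT) linear0l.
    by rewrite lT linearDl/= dotZl => -> ->; rewrite mulr0 addr0.
  have [hT|/existsNP[x0 hx0]] := pselect (forall x, dot (T x) y = 0).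
    by exists 0 => x; rewrite hT linear0r.
  have [p [cp op]] := projection_point x0 sM.
  have {cp} Mp : dot (T p) y = 0 by apply: closure_dot bT _ _ cp => m.
  pose z := x0 - p; pose f := dot (T z) y.
  have f0 : f != 0 by rewrite /f /z (linB lT) linearBl/= Mp subr0; exact/eqP.
  have z0 : dot z z != 0.
    apply: contra_neq f0 => /eqP; rewrite dnorm_eq0 => /eqP z0.
    by rewrite /f z0 (lin0 lT) linear0l.
  exists ((f / dot z z)^*%C *: z) => x; rewrite dotZr conjcK.
  have : M (x - (dot (T x) y / f) *: z).
    by rewrite /M /= (linB lT) (linZ lT) linearBl/= dotZl -/f divfK// subrr.
  move=> /op; rewrite -/z dotC linearBl/= dotZl.
  move=> /(congr1 (@conjc R)); rewrite conjcK rmorph0 => /eqP; rewrite subr_eq0 => /eqP ->.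
  by field; apply/andP.
exists S; split; last by move=> x y; rewrite hS.
have [k k0 hk] := bop_bound Hnorm bT.
apply/(bounded_opP Hnorm); split=> [a x y|].
  apply: (@dot_injr _ _ dot) => z.
  by rewrite -hS !linearDr/= !dotZr -!hS.
exists k => // y; have [->|s0] := eqVneq (nm (S y)) 0; first by rewrite mulr_ge0 ?nm_ge0.
have sp : 0 < nm (S y) by rewrite lt_def s0 nm_ge0.
rewrite -(ler_pM2l sp) -expr2 sqr_nm.
have -> : nsq (S y) = rdot (T (S y)) y by rewrite /hnormsq /redot hS.
rewrite (le_trans (ler_norm _))// (le_trans (rdot_le _ _ _))//.
by rewrite mulrCA mulrA ler_wpM2r ?nm_ge0.
Qed.

Lemma adjointP T : bounded_op T ->
  bounded_op (adjoint dot T) /\ forall x y, dot (T x) y = dot x (adjoint dot T y).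
Proof. by move=> /adjoint_exists[S hS]; rewrite /adjoint; case: xgetP => [U _ //|/(_ S)]. Qed.

End Projection.

(** * Range inclusion and generalized inverses *)

Section Douglas.
Context {R : realType} {H : completeNormedModType R[i]}.
Variable dot : {dot H for Num.conj}.
Hypothesis Hnorm : hilbert_norm dot.
Local Notation nm := (hnorm dot).
Local Notation nsq := (hnormsq dot).
Local Notation rdot := (redot dot).
Local Notation adj := (adjoint dot).
Implicit Types (x y z : H) (M : set H) (T : H -> H).

(** Uniform boundedness, by a gliding hump instead of a category argument. *)
Lemma weakly_bounded (E : set H) :
  (forall x, exists k : R, forall g, E g -> `|rdot x g| <= k) ->
  exists K : R, forall g, E g -> nm g <= K.
Proof.
move=> wE; apply: contrapT => /forallNP hE.
pose q (n : nat) : R := 3^-1 ^+ n.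
have q_gt0 n : 0 < q n by rewrite exprn_gt0.
have /choice[g hg] n : exists g, E g /\ 2 * n.+1%:R / q n < nm g.
  have /existsNP[g /not_implyP[Eg /negP]] := hE (2 * n.+1%:R / q n).
  by rewrite -ltNge; exists g.
have g0 n : 0 < nm (g n).
  by apply: lt_trans (hg n).2; rewrite divr_gt0// mulr_gt0.
pose v n := (q n / nm (g n))%:C *: g n.
have vn n : nm (v n) = q n.
  by rewrite nmZ ger0_norm ?divfK ?gt_eqF// ltW// divr_gt0.
have vg n : rdot (v n) (g n) = q n * nm (g n).
  by rewrite rdotZl -/(nsq _) -sqr_nm; field; rewrite gt_eqF.
(* The pairings of [x m + v m] and [x m - v m] with [g m] differ by twice [q m * nm (g m)], so one
   of them is at least that large in absolute value; the sign is chosen accordingly. *)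
pose x := fix x n := if n is m.+1 then
  (if `|rdot (x m - v m) (g m)| <= `|rdot (x m + v m) (g m)|
   then x m + v m else x m - v m) else 0.
have xS n : nm (x n.+1 - x n) = q n.
  by rewrite /=; case: ifP => _; rewrite addrAC subrr add0r ?nmN vn.
have xg n : q n * nm (g n) <= `|rdot (x n.+1) (g n)|.
  rewrite /=; set a := rdot (x n - v n) (g n); set b := rdot (x n + v n) (g n).
  have : 2 * (q n * nm (g n)) = b - a.
    by rewrite -vg /a /b rdotBl rdotDl; ring.
  have := ler_normB b a => h e; have := ler_norm (b - a).
  case: (lerP `|a| `|b|) => hab; lra.
have xb n m : (n <= m)%N -> nm (x m - x n) <= 3 / 2 * (q n - q m).
  elim: m => [|m IH]; first by rewrite leqn0 => /eqP ->; rewrite !subrr nm0 mulr0.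
  rewrite leq_eqVlt => /predU1P[->|]; first by rewrite !subrr nm0 mulr0.
  rewrite ltnS => /IH h; rewrite (le_trans (nm_dist _ _ (x m) _))// xS.
  have : q m.+1 = 3^-1 * q m by rewrite /q exprS.
  by lra.
have [e e0||l hl] := @complete_nm _ _ dot Hnorm x (fun n => 3 / 2 * q n).
- have e2 : 0 < e / 2 by rewrite divr_gt0.
  have [n hn] := ex_invS_lt e2; exists n; have h : q n <= n.+1%:R^-1.
    rewrite /q exprVn lef_pV2 ?posrE ?exprn_gt0//.
    by rewrite -natrX ler_nat; apply: ltn_expl.
  have := le_lt_trans h hn; have := q_gt0 n; rewrite /=; move: (q n) => r. lra.
- by move=> n m /xb h; apply: le_trans h _; have := q_gt0 m; lra.
have [k hk] := wE l.
have [n hn] : exists n : nat, k < n.+1%:R.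
  by exists (Num.bound `|k|); rewrite (le_lt_trans (ler_norm _))// (lt_trans (archi_boundP _))// ltr_nat.
have h1 := hk _ (hg n).1.
have h2 := le_trans (rdot_le dot (l - x n.+1) (g n)) (ler_wpM2r (nm_ge0 _ _) (hl n.+1)).
have h3 := xg n.
have h4 : `|rdot (x n.+1) (g n)| <= `|rdot l (g n)| + `|rdot (l - x n.+1) (g n)|.
  have -> : rdot (x n.+1) (g n) = rdot l (g n) - rdot (l - x n.+1) (g n).
    by rewrite rdotBl; ring.
  exact: ler_normB.
have := (hg n).2; rewrite ltr_pdivrMr// => h5.
(* The ratio 1/3 makes the tail after step [n] cost at most half of the hump, so [l] still pairs
   with [g n] to more than [n.+1], beyond the bound [k]. *)
have E3 : 3 / 2 * q n.+1 * nm (g n) = q n * nm (g n) / 2.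
  by rewrite /q exprS; field.
rewrite E3 in h2; lra.
Qed.

Lemma rdot_adj T x y : bounded_op T -> rdot (T x) y = rdot x (adj T y).
Proof. by move=> /(adjointP Hnorm)[_ h]; rewrite /redot h. Qed.

Lemma dot_adj T x y : bounded_op T -> dot (T x) y = dot x (adj T y).
Proof. by move=> /(adjointP Hnorm)[_ h]; rewrite h. Qed.

Lemma dot_adjl T x y : bounded_op T -> dot (adj T x) y = dot x (T y).
Proof. by move=> bT; rewrite dotC -dot_adj// -dotC. Qed.

Lemma bop_adj T : bounded_op T -> bounded_op (adj T).
Proof. by move=> /(adjointP Hnorm)[]. Qed.

Lemma subspace_range T : linear T -> subspace (range T).
Proof.
move=> lT; split; first by exists 0 => //; exact: lin0.
by move=> a _ _ [x _ <-] [y _ <-]; exists (a *: x + y) => //; rewrite lT.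
Qed.

Lemma subspace_null T : linear T -> subspace (nullspace T).
Proof.
move=> lT; split; first exact: lin0.
by move=> a x y; rewrite /nullspace /= lT => -> ->; rewrite scaler0 addr0.
Qed.

Lemma closed_null T x : bounded_op T -> closure (nullspace T) x -> T x = 0.
Proof.
move=> bT cx; apply: (@rdot_inj _ _ dot) => z; rewrite rdot0l /redot.
by rewrite (closure_dot Hnorm bT _ cx)// => m ->; rewrite linear0l.
Qed.

Lemma perp_null_inj T x y : linear T -> perp dot (nullspace T) x ->
  perp dot (nullspace T) y -> T x = T y -> x = y.
Proof.
move=> lT px py e; apply/eqP; rewrite -subr_eq0 -(dnorm_eq0 dot).
have n0 : nullspace T (x - y) by rewrite /nullspace /= (linB lT) e subrr.
by rewrite linearBl/= px// py// subrr.
Qed.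

Lemma mp_invP T y : bounded_op T -> mp_dom dot T y ->
  perp dot (nullspace T) (mp_inv dot T y) /\
  perp dot (range T) (y - T (mp_inv dot T y)).
Proof.
move=> bT [_ [x _ <-] [v pv <-]]; have lT := bop_linear bT.
have [p [cp op]] := projection_point Hnorm x (subspace_null lT).
rewrite /mp_inv; set t := T x + v; case: xgetP => [u _ [pu [w pw e]]|/(_ (x - p)) []].
  split => //; suff -> : t - T u = w by [].
  by rewrite e addrC addKr.
split; first by move=> z /op.
by exists v; rewrite // (linB lT) (closed_null bT cp) subr0.
Qed.

Lemma mp_dom_range T x : mp_dom dot T (T x).
Proof. by exists (T x); [exists x|exists 0; [move=> y _; rewrite linear0l|rewrite addr0]]. Qed.

Lemma mp_invK T x : bounded_op T -> T (mp_inv dot T (T x)) = T x.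
Proof.
move=> bT; have lT := bop_linear bT.
have [_ /(_ (T (x - mp_inv dot T (T x))))] := mp_invP bT (mp_dom_range T x).
rewrite -(linB lT) => /(_ (imageP _ I)) /eqP; rewrite dnorm_eq0 (linB lT) subr_eq0.
by move=> /eqP/esym.
Qed.

(** [T] need not have closed range. For [nm (adj T z) <= 1] the vectors [adj G z] are weakly
    bounded, since [rdot x (adj G z) = rdot (Y x) (adj T z)]; uniform boundedness then controls
    [adj G] by [adj T]. As [Y x] lies in the closure of the range of [adj T], testing against nearby
    [adj T z] gives [nm (Y x) <= K * nm x]. *)
Lemma bop_mp_inv T G : bounded_op T -> bounded_op G -> range G `<=` range T ->
  bounded_op (mp_inv dot T \o G) /\ forall x, T (mp_inv dot T (G x)) = G x.
Proof.
move=> bT bG GT; have lT := bop_linear bT; have lG := bop_linear bG.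
set Y := mp_inv dot T \o G.
have TY x : T (Y x) = G x.
  by have [u _ e] : range T (G x) := GT _ (imageP _ I); rewrite /Y /= -e mp_invK.
split; last exact: TY.
have pY x : perp dot (nullspace T) (Y x).
  have [u _ e] : range T (G x) := GT _ (imageP _ I).
  by rewrite /Y /= -e; have [] := mp_invP bT (mp_dom_range T u).
have [K hK] : exists K, forall g, [set adj G z | z in [set z | nm (adj T z) <= 1]] g -> nm g <= K.
  apply: weakly_bounded => x; exists (nm (Y x)) => _ [z /= hz <-].
  rewrite -(rdot_adj x z bG) -TY (rdot_adj _ _ bT) (le_trans (rdot_le _ _ _))//.
  by rewrite -[leRHS]mulr1 ler_wpM2l ?nm_ge0.
have K0 : 0 <= K.
  apply: le_trans (nm_ge0 dot (adj G 0)) (hK _ _); exists 0 => //=.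
  by rewrite (lin0 (bop_linear (bop_adj bT))) nm0.
(* A positive upper bound [t] replaces [nm (adj T z)], which may vanish and could not be divided
   by. *)
have Kt z t : 0 < t -> nm (adj T z) <= t -> nm (adj G z) <= K * t.
  move=> t0 hz; have /hK : [set adj G z | z in [set z | nm (adj T z) <= 1]] (adj G (t^-1%:C *: z)).
    exists (t^-1%:C *: z) => //=.
    rewrite (linZ (bop_linear (bop_adj bT))) nmZ ger0_norm ?invr_ge0 ?(ltW t0)//.
    by rewrite mulrC ler_pdivrMr// mul1r.
  rewrite (linZ (bop_linear (bop_adj bG))) nmZ ger0_norm ?invr_ge0 ?(ltW t0)//.
  by rewrite mulrC ler_pdivrMr.
apply/(bounded_opP Hnorm); split=> [a x y|].
  apply: (@perp_null_inj T) => //; last by rewrite lT !TY lG.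
  by move=> z nz; rewrite linearDl/= dotZl !pY// mulr0 addr0.
exists K => // x.
have cY : closure (range (adj T)) (Y x).
  have [p [cp op]] := projection_point Hnorm (Y x) (subspace_range (bop_linear (bop_adj bT))).
  suff -> : Y x = p by [].
  have n0 : nullspace T (Y x - p).
    apply: (@rdot_inj _ _ dot) => z; rewrite rdot0l rdot_adj// /redot.
    by rewrite op//; exists z.
  apply/eqP; rewrite -subr_eq0 -(dnorm_eq0 dot) [in X in X == _]linearBl/= pY//.
  rewrite sub0r oppr_eq0; apply/eqP.
  apply: (@closure_dot _ _ dot Hnorm id _ _ (bop_id Hnorm) _ _ cp) => _ [z _ <-].
  by rewrite dot_adjl// n0 linear0r.
have [->|Y0] := eqVneq (nm (Y x)) 0; first by rewrite mulr_ge0 ?nm_ge0.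
have Yp : 0 < nm (Y x) by rewrite lt_def Y0 nm_ge0.
rewrite -(ler_pM2l Yp) -expr2 sqr_nm; apply/ler_addgt0Pr => e e0.
(* Approximating [Y x] within [e / c] produces errors [nm (Y x) * (e / c)] and [K * nm x * (e / c)],
   which add up to [e]. *)
pose c := nm (Y x) + K * nm x.
have c0 : 0 < c by rewrite ltr_wpDr// mulr_ge0 ?nm_ge0.
have d0 := divr_gt0 e0 c0.
move/(closure_nm Hnorm): cY => /(_ _ d0)[_ [z _ <-] hz].
have h1 : nm (adj T z) <= nm (Y x) + e / c.
  rewrite -[adj T z](subrK (Y x)) addrC (le_trans (nm_triangle _ _ _))// lerD2l.
  by rewrite nmBC ltW.
have h2 := Kt _ _ (addr_gt0 Yp d0) h1.
have h3 : nsq (Y x) = rdot (Y x) (Y x - adj T z) + rdot x (adj G z).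
  by rewrite -(rdot_adj x z bG) -TY (rdot_adj _ _ bT) -rdotDr subrK.
have h4 := le_trans (ler_norm _) (rdot_le dot (Y x) (Y x - adj T z)).
have h5 := le_trans (ler_norm _) (rdot_le dot x (adj G z)).
have h6 := ler_wpM2l (nm_ge0 dot (Y x)) (ltW hz).
have h7 := ler_wpM2l (nm_ge0 dot x) h2.
have -> : e = nm (Y x) * (e / c) + nm x * K * (e / c).
  by rewrite -mulrDl [nm x * K]mulrC -/c mulrC divfK// gt_eqF.
rewrite h3; lra.
Qed.

Lemma closed_range_proj T : bounded_op T -> closed (range T) ->
  exists2 P : H -> H, bounded_op P &
    (forall x, range T (P x)) /\ (forall x y, dot (x - P x) (T y) = 0).
Proof.
move=> bT cT; have [P bP [cP oP]] := projection Hnorm (subspace_range (bop_linear bT)).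
exists P => //; split=> [x|x y].
  by have := cP x; rewrite -(closure_id _).1.
by apply: oP; apply: subset_closure; exists y.
Qed.

Lemma mp_dom_closed T x : bounded_op T -> closed (range T) -> mp_dom dot T x.
Proof.
move=> bT /(closed_range_proj bT)[P bP [rP oP]].
exists (P x) => //; exists (x - P x); last by rewrite addrC subrK.
by move=> _ [y _ <-].
Qed.

(** Composing [mp_inv T] with the projection on the range puts it in the form whose boundedness
    [bop_mp_inv] supplies. *)
Lemma closed_range_inner_inv T : bounded_op T -> closed (range T) ->
  exists2 S : H -> H, bounded_op S & forall x, T (S (T x)) = T x.
Proof.
move=> bT /(closed_range_proj bT)[P bP [rP oP]].
have [|bS TS] := bop_mp_inv bT bP; first by move=> _ [x _ <-]; exact: rP.
exists (mp_inv dot T \o P) => //= x; rewrite TS.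
have [u _ e] := rP (T x); apply/esym/eqP; rewrite -subr_eq0 -(dnorm_eq0 dot).
by rewrite -[in X in dot _ X]e -(linB (bop_linear bT)) oP.
Qed.

End Douglas.

(** * Square roots of positive operators *)

Section SquareRoot.
Context {R : realType} {H : completeNormedModType R[i]}.
Variable dot : {dot H for Num.conj}.
Hypothesis Hnorm : hilbert_norm dot.
Local Notation nm := (hnorm dot).
Local Notation nsq := (hnormsq dot).
Local Notation rdot := (redot dot).
Local Notation adj := (adjoint dot).
Implicit Types (x y z : H) (M : set H) (T W : H -> H).

Lemma nm_small x (K : R) : (forall e, 0 < e -> nm x <= e * K) -> x = 0.
Proof.
move=> h; apply/eqP; rewrite -(nm_eq0 dot); apply/eqP.
by apply: (@small_eq0 _ _ K) => e /h; rewrite ger0_norm// nm_ge0.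
Qed.

Lemma dot_ge0 x y : (0 <= dot x y) <-> (0 <= rdot x y /\ rdot x ('i *: y) = 0).
Proof.
rewrite rdot_ir /redot lecE /=; case: (dot x y) => a b /=.
by split=> [/andP[/eqP -> ->]|[-> ->]] //; rewrite eqxx.
Qed.

Lemma pos_op_ge0 T x : pos_op dot T -> 0 <= rdot (T x) x.
Proof. by move=> [_ /(_ x)] /dot_ge0[]. Qed.

(** Polarization: the form is real at [x + y] and at [x + 'i *: y], which ties [dot (T x) y] to the
    conjugate of [dot (T y) x]. *)
Lemma pos_op_sym T x y : pos_op dot T -> dot (T x) y = dot x (T y).
Proof.
move=> [bT pT]; have lT := bop_linear bT.
have im z : complex.Im (dot (T z) z) = 0 by apply/ger0_Im/pT.
have imD z w : complex.Im (dot (T z) w) + complex.Im (dot (T w) z) = 0.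
  have := im (z + w); rewrite (linD lT) linearDl/= !linearDr/=.
  move: (im z) (im w); case: (dot (T z) z) => a b; case: (dot (T w) w) => c d.
  case: (dot (T z) w) => e f; case: (dot (T w) z) => g h /= -> ->.
  by rewrite add0r addr0.
have h1 := imD x y; have := imD x ('i *: y).
rewrite (linZ lT) dotZr dotZl.
move=> h2; rewrite [RHS]dotC; move: h1 h2; case: (dot (T x) y) => a b; case: (dot (T y) x) => c d /=.
by move=> h1 h2; apply/eqP; rewrite eq_complex /=; apply/andP; split; apply/eqP; lra.
Qed.

Lemma pos_op_rsym T x y : pos_op dot T -> rdot (T x) y = rdot x (T y).
Proof. by move=> pT; rewrite /redot pos_op_sym. Qed.

(** Positivity at [x - T x] together with the bound at [T x] gives [nsq (T x) <= rdot (T x) x]. *)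
Lemma pos_op_contr T : pos_op dot T -> (forall x, rdot (T x) x <= nsq x) ->
  forall x, nm (T x) <= nm x.
Proof.
move=> pT T1 x; have lT := bop_linear pT.1.
have := pos_op_ge0 (x - T x) pT; have := T1 x; have := T1 (T x).
rewrite (linB lT) rdotBl !rdotBr (pos_op_rsym (T x) x pT) -/(nsq _) le_nm; lra.
Qed.

Section SqrtContraction.
Variable W : H -> H.
Hypotheses (pW : pos_op dot W) (W1 : forall x, rdot (W x) x <= nsq x).

Let A x := x - W x.

Let pA : pos_op dot A.
Proof.
split; first exact: (bop_sub (bop_id Hnorm) pW.1).
move=> x; rewrite /A linearBl/= dot_nsq; have := W1 x; have := pW.2 x.
rewrite /redot !lecE; case: (dot (W x) x) => a b /= /andP[/eqP -> _] h.
by rewrite oppr0 addr0 eqxx /= subr_ge0.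
Qed.

Let lA : linear A. Proof. exact: bop_linear pA.1. Qed.

Let A1 x : nm (A x) <= nm x.
Proof.
apply: pos_op_contr pA _ x => x; rewrite /A rdotBl -/(nsq _).
by rewrite gerBl pos_op_ge0.
Qed.

(** Iteration for [Z = (A + Z^2) / 2] with [A = 1 - W]: a solution satisfies [(1 - Z)^2 = W], so
    [1 - Z] is the square root. *)
Let Y := fix Y n : H -> H := if n is m.+1 then
  fun x => (2^-1 : R)%:C *: (A x + Y m (Y m x)) else fun=> 0.
(** The same iteration with [A] replaced by the scalar 1; it is increasing and dominates the norms
    and increments of [Y]. *)
Let y := fix y n : R := if n is m.+1 then (1 + y m ^+ 2) / 2 else 0.

Let y01 n : 0 <= y n <= 1.
Proof. by elim: n => [|n /andP[h0 h1]] /=; rewrite ?lexx ?ler01//; apply/andP; split; nra. Qed.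

Let yS n : y n <= y n.+1.
Proof. by have /andP[h0 h1] := y01 n; rewrite /=; nra. Qed.

Let lY n : linear (Y n).
Proof.
elim: n => [|n IH] a u v /=; first by rewrite scaler0 addr0.
rewrite lA IH IH addrACA -scalerDr !scalerDr !scalerA.
by rewrite (mulrC a).
Qed.

(** Commuting iterates let the difference of squares in [YSB] factor as [Y n.+1 - Y n] applied to
    [Y n.+1 x + Y n x]. *)
Let Ycomm n (B : H -> H) : linear B -> (forall x, A (B x) = B (A x)) ->
  forall x, Y n (B x) = B (Y n x).
Proof.
move=> lB AB; elim: n => [|n IH] x /=; first by rewrite (lin0 lB).
by rewrite !IH AB -(linD lB) -(linZ lB).
Qed.

Let YA n x : Y n (A x) = A (Y n x). Proof. exact: Ycomm. Qed.
Let YY n m x : Y n (Y m x) = Y m (Y n x). Proof. by apply: Ycomm. Qed.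

Let Yy n x : nm (Y n x) <= y n * nm x.
Proof.
elim: n x => [|n IH] x /=; first by rewrite nm0 mul0r.
have /andP[h0 h1] := y01 n.
rewrite nmZ ger0_norm ?invr_ge0// mulrC ler_pdivrMr//.
have := le_trans (nm_triangle dot (A x) (Y n (Y n x))) (lerD (A1 x) (IH (Y n x))).
have := ler_wpM2l h0 (IH x); lra.
Qed.

Let YSB n x : nm (Y n.+1 x - Y n x) <= (y n.+1 - y n) * nm x.
Proof.
elim: n x => [|n IH] x.
  rewrite /= !subr0 addr0 expr0n /= addr0 nmZ ger0_norm ?invr_ge0// mul1r.
  by rewrite ler_wpM2l ?invr_ge0.
pose z := Y n.+1 x + Y n x.
have -> : Y n.+2 x - Y n.+1 x = (2^-1 : R)%:C *: (Y n.+1 z - Y n z).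
  by rewrite /z !(linD (lY _)) (YY n n.+1) [Y n.+2 x]/= [in LHS]/=; vector_ring dot.
rewrite nmZ ger0_norm ?invr_ge0// mulrC ler_pdivrMr//.
apply: le_trans (IH z) _.
have h : nm z <= (y n.+1 + y n) * nm x.
  by rewrite (le_trans (nm_triangle _ _ _))// mulrDl lerD.
have := ler_wpM2l _ h => /(_ (y n.+1 - y n)); rewrite subr_ge0 => /(_ (yS n)).
move=> /le_trans; apply; rewrite mulrA [leRHS]mulrAC ler_wpM2r ?nm_ge0//.
have -> : y n.+2 = (1 + y n.+1 ^+ 2) / 2 by [].
have -> : y n.+1 = (1 + y n ^+ 2) / 2 by [].
lra.
Qed.

Let YB n m x : (n <= m)%N -> nm (Y m x - Y n x) <= (y m - y n) * nm x.
Proof.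
elim: m => [|m IH]; first by rewrite leqn0 => /eqP ->; rewrite !subrr nm0 mul0r.
rewrite leq_eqVlt => /predU1P[->|]; first by rewrite !subrr nm0 mul0r.
rewrite ltnS => /IH h; rewrite (le_trans (nm_dist _ _ (Y m x) _))//.
have := YSB m x; lra.
Qed.

Let Ysym n x z : dot (Y n x) z = dot x (Y n z).
Proof.
elim: n x z => [|n IH] x z /=; first by rewrite linear0l linear0r.
rewrite dotZl dotZr conjc_real dotDl [in RHS]linearDr/= (pos_op_sym _ _ pA).
by rewrite !IH.
Qed.

Lemma sqrt_contraction : exists S, pos_op dot S /\ S \o S = W.
Proof.
pose E : set R := range y.
have E0 : E !=set0 by exists (y 0%N), 0%N.
have hE : has_sup E by split => //; exists 1 => _ [n _ <-]; case/andP: (y01 n).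
(* [L - y n] is the rate of convergence of [Y n], and [L <= 1] makes the limit a contraction. *)
pose L := sup E.
have yL n : y n <= L by apply: sup_upper_bound => //; exists n.
have L1 : L <= 1 by apply: ge_sup => // _ [n _ <-]; case/andP: (y01 n).
have Le e : 0 < e -> exists n, L - y n < e.
  move=> e0; have [_ [n _ <-] h] := sup_adherent e0 hE.
  by exists n; rewrite -/L in h; lra.
have /choice[Z hZ] x : exists l, forall n, nm (l - Y n x) <= (L - y n) * nm x.
  apply: (complete_nm Hnorm) => [e e0|n m nm].
    have x0 : 0 < nm x + 1 by rewrite ltr_wpDl ?nm_ge0.
    have [n hn] := Le _ (divr_gt0 e0 x0); exists n.
    have : (L - y n) * (nm x + 1) < e by rewrite -ltr_pdivlMr.
    by have := yL n; rewrite -subr_ge0; lra.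
  apply: le_trans (YB x nm) _; rewrite ler_wpM2r ?nm_ge0//.
  by rewrite lerD2r.
have Lsmall z K : 0 <= K -> (forall n, nm z <= (L - y n) * K) -> z = 0.
  move=> K0 h; apply: (@nm_small _ K) => e e0.
  have [n hn] := Le _ e0; apply: le_trans (h n) _.
  by rewrite ler_wpM2r// ltW.
have lZ : linear Z.
  move=> a u v; apply/eqP; rewrite -subr_eq0; apply/eqP.
  have a0 : 0 <= complex.Re `|a| by have := normr_ge0 a; rewrite lecE => /andP[].
  apply: (Lsmall _ (nm (a *: u + v) + (complex.Re `|a| * nm u + nm v))) => [|n].
    by rewrite !addr_ge0 ?mulr_ge0 ?nm_ge0.
  have -> : Z (a *: u + v) - (a *: Z u + Z v) = (Z (a *: u + v) - Y n (a *: u + v))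
      - (a *: (Z u - Y n u) + (Z v - Y n v)).
    by rewrite lY; vector_ring dot.
  rewrite (le_trans (nm_triangle _ _ _))// nmN mulrDr lerD//.
  rewrite (le_trans (nm_triangle _ _ _))// mulrDr lerD// (nmZc Hnorm) mulrCA.
  by rewrite ler_wpM2l.
have Zn x : nm (Z x) <= nm x.
  by have := hZ x 0%N; rewrite /= !subr0 => /le_trans; apply; rewrite ler_piMl ?nm_ge0.
have ZZ x : Z x = (2^-1 : R)%:C *: (A x + Z (Z x)).
  apply/eqP; rewrite -subr_eq0; apply/eqP; apply: (Lsmall _ (2 * nm x)) => [|n].
    by rewrite mulr_ge0 ?nm_ge0.
  have -> : Z x - (2^-1 : R)%:C *: (A x + Z (Z x)) = (Z x - Y n.+1 x)
    - (2^-1 : R)%:C *: ((Z (Z x) - Y n (Z x)) + Y n (Z x - Y n x)).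
    by rewrite (linB (lY n)) /=; vector_ring dot.
  rewrite (le_trans (nm_triangle _ _ _))// nmN nmZ ger0_norm ?invr_ge0//.
  have h1 := hZ x n.+1; have h2 := hZ (Z x) n; have h3 := Yy n (Z x - Y n x).
  have h4 := hZ x n; have /andP[h5 h6] := y01 n.
  have h7 := ler_wpM2r (nm_ge0 dot (Z x - Y n x)) h6.
  have h8 : (L - y n) * nm (Z x) <= (L - y n) * nm x.
    by rewrite ler_wpM2l// subr_ge0.
  have h9 : (L - y n.+1) * nm x <= (L - y n) * nm x.
    by rewrite ler_wpM2r ?nm_ge0// lerD2l lerN2.
  have := nm_triangle dot (Z (Z x) - Y n (Z x)) (Y n (Z x - Y n x)).
  move: (y n.+1) h9 h1 => w; lra.
have bZ : bounded_op Z.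
  by apply/(bounded_opP Hnorm); split=> //; exists 1 => // x; rewrite mul1r.
exists (fun x => x - Z x); split; last first.
  apply/funext => x /=; rewrite (linB lZ).
  have e : Z (Z x) = Z x + Z x - A x.
    have := ZZ x => /(congr1 (fun u => (2 : R)%:C *: u)).
    rewrite scalerA -rmorphM divff// scale1r => e2.
    by apply: (addrI (A x)); rewrite -e2 addrC subrK rmorphD /= scalerDl scale1r.
  by rewrite e /A; vector_ring dot.
split; first exact: (bop_sub (bop_id Hnorm) bZ).
move=> x; apply/dot_ge0; split.
  rewrite rdotBl -/(nsq _) subr_ge0 (le_trans (ler_norm _))// (le_trans (rdot_le _ _ _))//.
  by rewrite -sqr_nm expr2 ler_wpM2r ?nm_ge0.
rewrite rdotBl; have -> : rdot x ('i *: x) = 0.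
  by rewrite rdot_ir dot_nsq.
rewrite sub0r; apply/eqP; rewrite oppr_eq0; apply/eqP.
apply: (@small_eq0 _ _ (nm x * nm x)) => e /Le[n hn].
(* Symmetry of the iterates makes their forms real; the limit inherits this. *)
have Y0 : rdot (Y n x) ('i *: x) = 0.
  rewrite rdot_ir; have := Ysym n x x; rewrite [RHS]dotC; case: (dot _ _) => a b /= [] h; lra.
rewrite -[rdot _ _]subr0 -Y0 -rdotBl (le_trans (rdot_le _ _ _))// nmi mulrA.
rewrite ler_wpM2r ?nm_ge0// (le_trans (hZ _ n))// ler_wpM2r ?nm_ge0//.
exact: ltW.
Qed.

End SqrtContraction.

Lemma op_sqrt_exists W : pos_op dot W -> exists S, pos_op dot S /\ S \o S = W.
Proof.
move=> pW; have [k k0 hk] := bop_bound Hnorm pW.1.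
have scale_pos (a : R) T : 0 <= a -> pos_op dot T -> pos_op dot (fun x => a%:C *: T x).
  move=> a0 [bT pT]; split; first exact: bop_scale.
  by move=> x; rewrite dotZl mulr_ge0// ler0c.
(* Dividing by [k + 1], nonzero even for [k = 0], brings the operator below the identity. *)
have k1 : 0 < k + 1 by rewrite ltr_wpDl.
have [||S [pS SW]] := @sqrt_contraction (fun x => ((k + 1)^-1)%:C *: W x).
- by apply: scale_pos => //; rewrite invr_ge0 ltW.
- move=> x; rewrite rdotZl mulrC ler_pdivrMr// (le_trans (ler_norm _))//.
  rewrite (le_trans (rdot_le _ _ _))// -sqr_nm.
  have := ler_wpM2r (nm_ge0 dot x) (hk x); have := sqr_ge0 (nm x); lra.
exists (fun x => (Num.sqrt (k + 1))%:C *: S x); split.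
  by apply: scale_pos => //; exact: sqrtr_ge0.
apply/funext => x /=; rewrite (linZ (bop_linear pS.1)) scalerA -rmorphM -expr2 sqr_sqrtr ?(ltW k1)//.
have -> : S (S x) = ((k + 1)^-1)%:C *: W x by rewrite -[LHS]/((S \o S) x) SW.
by rewrite scalerA -rmorphM divff ?gt_eqF// scale1r.
Qed.

Lemma op_sqrtP W : pos_op dot W -> pos_op dot (op_sqrt dot W) /\
  forall x, op_sqrt dot W (op_sqrt dot W x) = W x.
Proof.
move=> /op_sqrt_exists[S hS]; rewrite /op_sqrt; case: xgetP => [U _ [pU UW]|/(_ S)//].
by split => // x; rewrite -UW.
Qed.

Lemma pos_adjK T : bounded_op T -> pos_op dot (adj T \o T).
Proof.
move=> bT; split; first exact: (bop_comp Hnorm (bop_adj Hnorm bT) bT).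
by move=> x /=; rewrite dot_adjl// dnorm_ge0.
Qed.

Lemma op_absP T : bounded_op T -> pos_op dot (op_abs dot T) /\
  forall x, op_abs dot T (op_abs dot T x) = adj T (T x).
Proof. by move=> /pos_adjK/op_sqrtP. Qed.

End SquareRoot.

(** * Singular vectors of a compact operator *)

Section SingularValues.
Context {R : realType} {H : completeNormedModType R[i]}.
Variable dot : {dot H for Num.conj}.
Hypothesis Hnorm : hilbert_norm dot.
Local Notation nm := (hnorm dot).
Local Notation nsq := (hnormsq dot).
Local Notation rdot := (redot dot).
Local Notation adj := (adjoint dot).
Implicit Types (x y z : H) (M : set H) (T W : H -> H) (f : nat -> H).

(** Any compact set containing the image of the unit ball is accepted, so that composition on the
    right only rescales [K]. *)
Definition precompact_op T := bounded_op T /\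
  exists2 K : set H, compact K & forall x, nm x <= 1 -> K (T x).

Lemma le_nm_scale T (V : set H) (l : R) : linear T -> subspace V ->
  (forall x, V x -> nm x <= 1 -> nsq (T x) <= l) ->
  forall x, V x -> nsq (T x) <= l * nsq x.
Proof.
move=> lT sV h x Vx; have [->|x0] := eqVneq x 0.
  by rewrite (lin0 lT) nsq0 mulr0.
have n0 : 0 < nm x by rewrite nm_gt0.
have := h _ (subspaceZ (nm x)^-1%:C sV Vx).
rewrite nmZ (linZ lT) nsqZ ger0_norm ?invr_ge0 ?nm_ge0// mulVf ?gt_eqF// => /(_ (lexx _)).
by rewrite exprVn sqr_nm mulrC ler_pdivrMr// -sqr_nm exprn_gt0.
Qed.

Lemma continuous_nm : continuous (nm : H -> R).
Proof.
move=> x; apply/cvgrPdist_lt => e e0.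
apply/(nbhs_nm Hnorm); exists e => // y hy; apply: le_lt_trans hy.
rewrite ler_norml; apply/andP; split.
  have := nm_dist dot y x 0; rewrite !subr0 nmBC; lra.
have := nm_dist dot x y 0; rewrite !subr0; lra.
Qed.

(** The unit ball is not compact, so the maximum is taken over the closure of its image, at some
    [y]. A maximizing vector is then recovered as [P (adj T y)] divided by [l = nsq y]. *)
Lemma compact_max T (V : set H) : precompact_op T -> subspace V -> closure V `<=` V ->
  exists x, [/\ V x, forall z, V z -> dot (adj T (T x) - (nsq (T x))%:C *: x) z = 0,
    forall z, V z -> nsq (T z) <= nsq (T x) * nsq z &
    nm x = (0 < nsq (T x))%R%:R].
Proof.
move=> [bT [K cK TK]] sV cV; have lT := bop_linear bT.
pose E := [set T x | x in [set x | V x /\ nm x <= 1]].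
have [P bP [cP oP]] := projection Hnorm sV.
have E0 : closure E !=set0.
  exists 0; apply: subset_closure; exists 0; last exact: lin0.
  by split; [case: sV|rewrite nm0].
have cE : compact (closure E).
  apply: (subclosed_compact _ cK); first exact: closed_closure.
  have /closure_id -> : closed K by apply: compact_closed cK; exact: norm_hausdorff.
  by apply: closure_subset => _ [x [_ /TK]] + <-.
have [y /set_mem yE ymax] : exists2 y, y \in closure E & forall t, t \in closure E -> nm t <= nm y.
  by apply: compact_EVT_max => //; apply: continuous_subspaceT => x; exact: continuous_nm.
have Vy x : V x -> nsq (T x) <= nsq y * nsq x.
  apply: le_nm_scale => // {}x Vx x1; rewrite -le_nm; apply: ymax; apply/mem_set.
  by apply: subset_closure; exists x.
have [y0|y0] := eqVneq y 0.
  exists 0; rewrite (lin0 lT) nsq0 nm0; split=> //; first by case: sV.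
  - by move=> z Vz; rewrite (lin0 (bop_linear (bop_adj Hnorm bT))) scaler0 subr0 dot0l.
  - by move=> z /Vy; rewrite y0 nsq0.
  - by rewrite ltxx.
set l := nsq y in Vy *.
have l0 : 0 < l by rewrite lt_def nsq_eq0 y0 nsq_ge0.
have ln : nm y ^+ 2 = l by rewrite sqr_nm.
have yp : 0 < nm y by rewrite nm_gt0.
pose w := P (adj T y).
have Vw : V w by apply: cV; exact: cP.
have wx x : V x -> rdot w x = rdot y (T x).
  move=> Vx; rewrite [RHS]rdotC (rdot_adj Hnorm _ _ bT) [RHS]rdotC; apply/eqP.
  rewrite eq_sym -subr_eq0 -rdotBl; apply/eqP; rewrite /redot oP//.
  exact: subset_closure.
(* On the ball of [V], [rdot w x = rdot y (T x)] comes arbitrarily close to [nsq y = l]. *)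
have lw : l <= nm w.
  apply/ler_addgt0Pr => e e0.
  have /(closure_nm Hnorm)/(_ _ (divr_gt0 e0 yp))[_ [x [Vx x1] <-] hx] := yE.
  have := le_trans (ler_norm _) (rdot_le dot w x); rewrite (wx _ Vx).
  have -> : rdot y (T x) = l - rdot y (y - T x) by rewrite rdotBr opprB addrC subrK.
  have := le_trans (ler_norm _) (rdot_le dot y (y - T x)).
  have := ler_wpM2l (nm_ge0 dot y) (ltW hx); rewrite [leRHS]mulrC divfK ?gt_eqF//.
  have : nm w * nm x <= nm w by rewrite -[leRHS]mulr1 ler_wpM2l ?nm_ge0.
  lra.
have lw2 : l ^+ 2 <= nsq w by rewrite -sqr_nm ler_sqr ?nnegrE ?nm_ge0// ltW.
have Twy : rdot (T w) y = nsq w by rewrite rdotC -wx.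
(* The squared distance is at most [l * nsq w - 2 * l * nsq w + l ^+ 3], which is nonpositive
   because [nsq w >= l ^+ 2]. *)
have Tw : T w = l%:C *: y.
  apply/eqP; rewrite -subr_eq0 -(nsq_eq0 dot) eq_le nsq_ge0 andbT.
  rewrite nsqB nsqZ rdotZr Twy -/l; have := Vy _ Vw.
  have := ler_wpM2l (ltW l0) lw2; rewrite expr2; nra.
have nw : nsq w = l ^+ 2.
  by rewrite -Twy Tw rdotZl -/(nsq _) -/l expr2.
have Tx : T ((l^-1)%:C *: w) = y.
  by rewrite (linZ lT) Tw scalerA -rmorphM mulVf ?gt_eqF// scale1r.
have nx : nm ((l^-1)%:C *: w) = 1.
  rewrite nmZ /hnorm nw sqrtr_sqr -normrM mulVf ?gt_eqF//.
  by rewrite normr1.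
exists ((l^-1)%:C *: w); rewrite Tx -/l; split => //.
- exact: subspaceZ.
- move=> z Vz; rewrite scalerA -rmorphM divff ?gt_eqF// scale1r.
  by apply: oP; exact: subset_closure.
- by rewrite nx l0.
Qed.

Definition perps (s : seq H) : set H := [set x | forall y, y \in s -> dot x y = 0].

Lemma subspace_perps s : subspace (perps s).
Proof.
split; first by move=> y _; rewrite dot0l.
by move=> a x y px py z zs; rewrite dotDl dotZl px// py// mulr0 addr0.
Qed.

Lemma closed_perps s : closure (perps s) `<=` perps s.
Proof.
move=> x cx y ys; apply: (@closure_dot _ _ _ Hnorm id _ _ (bop_id Hnorm) _ _ cx) => m.
exact.
Qed.

(** Right singular vectors in decreasing order, the squared singular values being [nsq (T (f n))].
    By [svd_nm] each vector is a unit vector or 0, the zeros padding the sequence when the rank is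
    finite. [svd_max] is the extremal property behind min-max. *)
Record svd T f : Prop := Svd {
  svd_eigen : forall n, adj T (T (f n)) = (nsq (T (f n)))%:C *: f n;
  svd_orth : forall i j, i != j -> dot (f i) (f j) = 0;
  svd_max : forall n z, (forall i, (i < n)%N -> dot z (f i) = 0) ->
    nsq (T z) <= nsq (T (f n)) * nsq z;
  svd_nm : forall n, nm (f n) = (0 < nsq (T (f n)))%R%:R;
  svd_to0 : forall e, 0 < e -> exists n, nsq (T (f n)) < e }.

(** Successive maximization. On the complement of the earlier vectors [compact_max] gives the
    eigenvalue equation only up to a vector orthogonal to that complement; since the earlier vectors
    are eigenvectors, [adj T \o T] preserves the complement and the error vanishes. *)
Lemma svd_exists T : precompact_op T -> exists f, svd T f.
Proof.
move=> cT; have bT := cT.1; have lT := bop_linear bT.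
pose good s x := [/\ perps s x, adj T (T x) = (nsq (T x))%:C *: x,
  forall z, perps s z -> nsq (T z) <= nsq (T x) * nsq z &
    nm x = (0 < nsq (T x))%R%:R].
have goodE s : (forall y, y \in s -> adj T (T y) = (nsq (T y))%:C *: y) ->
    exists x, good s x.
  move=> hs.
  have [x [px ex mx nx]] := compact_max cT (subspace_perps s) (@closed_perps s).
  exists x; split => //; apply/eqP; rewrite -subr_eq0 -(dnorm_eq0 dot); apply/eqP.
  apply: ex; apply: (subspaceB (subspace_perps s)).
    move=> y ys; rewrite (dot_adjl Hnorm _ _ bT) (dot_adj Hnorm _ _ bT) hs//.
    by rewrite dotZr px// mulr0.
  exact: (subspaceZ _ (subspace_perps s)).
(* [G n] lists the first [n] vectors; by [fG] the default 0 of [xget] is never taken for want of a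
   good vector. *)
pose G := fix G n : seq H := if n is m.+1 then rcons (G m) (xget 0 (good (G m))) else [::].
pose f n := xget 0 (good (G n)).
have GP n y : (y \in G n) <-> exists2 i, (i < n)%N & y = f i.
  elim: n y => [|n IH] y; first by split => // -[].
  rewrite /= mem_rcons inE; split.
    move=> /orP[/eqP ->|/IH[i ni ->]]; first by exists n.
    by exists i => //; rewrite ltnS ltnW.
  move=> [k]; rewrite ltnS leq_eqVlt => /orP[/eqP -> ->|kn ->].
    by rewrite eqxx.
  by apply/orP; right; apply/IH; exists k.
have fG n : good (G n) (f n).
  elim/ltn_ind: n => n IH; apply: xgetPex; apply: goodE => y /GP[i ni ->].
  by case: (IH _ ni).
have orth i j : (i < j)%N -> dot (f j) (f i) = 0.
  by move=> ij; case: (fG j) => + _ _ _; apply; apply/GP; exists i.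
have orth' i j : i != j -> dot (f i) (f j) = 0.
  rewrite neq_ltn => /orP[] /orth // ji.
  by rewrite dotC ji rmorph0.
have mx n z : (forall i, (i < n)%N -> dot z (f i) = 0) -> nsq (T z) <= nsq (T (f n)) * nsq z.
  by move=> h; case: (fG n) => _ _ + _; apply=> y /GP[i ni ->]; exact: h.
have nmf n : nm (f n) = (0 < nsq (T (f n)))%R%:R by case: (fG n).
have ei n : adj T (T (f n)) = (nsq (T (f n)))%:C *: f n by case: (fG n).
exists f; split=> //.
(* Otherwise the orthogonal vectors [T (f n)] have squared norms at least [e], hence squared
   distances at least [2 * e], yet compactness brings two of them within [Num.sqrt e]. *)
move=> e e0; apply: contrapT => /forallNP h.
have he n : e <= nsq (T (f n)) by rewrite leNgt; apply/negP/h.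
have [K cK TK] := cT.2.
have [y [_ cy]] : K `&` cluster ((T \o f) @ \oo) !=set0.
  by apply: cK; exists 0%N => // n _ /=; apply: TK; rewrite nmf; case: (_ < _).
pose r := Num.sqrt e / 2; have r0 : 0 < r by rewrite divr_gt0// sqrtr_gt0.
have hnear n : exists2 m, (n <= m)%N & nm (y - T (f m)) < r.
  have [||z [[m nm' <-] hz]] := cy [set T (f m) | m in [set m | (n <= m)%N]] [set z | nm (y - z) < r].
  - by exists n => // m /= nm'; exists m.
  - by apply/(nbhs_nm Hnorm); exists r.
  by exists m.
have [n _ hn] := hnear 0%N; have [m nm' hm] := hnear n.+1.
have : nm (T (f n) - T (f m)) < Num.sqrt e.
  by apply: le_lt_trans (nm_dist _ _ y _) _; move: hn hm; rewrite nmBC /r; lra.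
have hs : Num.sqrt e ^+ 2 = e by rewrite sqr_sqrtr// ltW.
have c0 : rdot (T (f n)) (T (f m)) = 0.
  rewrite (rdot_adj Hnorm _ _ bT) ei rdotZr /redot orth' ?mulr0//.
  by rewrite neq_ltn nm'.
move=> h2; have : nsq (T (f n) - T (f m)) < e.
  by rewrite -hs -sqr_nm ltr_sqr ?nnegrE ?nm_ge0 ?sqrtr_ge0.
rewrite nsqB c0; have := he n; have := he m; lra.
Qed.

Lemma svd_nsq T f n : svd T f -> nsq (f n) = (0 < nsq (T (f n)))%R%:R.
Proof. by move=> sf; rewrite -sqr_nm (svd_nm sf); case: (_ < _); rewrite ?expr1n// expr0n. Qed.

Lemma svd_nsq_le1 T f n : svd T f -> nsq (f n) <= 1.
Proof. by move=> sf; rewrite (svd_nsq n sf); case: (_ < _). Qed.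

Lemma svd_decr T f n m : svd T f -> (n <= m)%N -> nsq (T (f m)) <= nsq (T (f n)).
Proof.
move=> sf; elim: m => [|m IH]; first by rewrite leqn0 => /eqP ->.
rewrite leq_eqVlt => /predU1P[-> //|]; rewrite ltnS => /IH; apply: le_trans.
have h : forall i, (i < m)%N -> dot (f m.+1) (f i) = 0.
  by move=> i im; apply: (svd_orth sf); rewrite neq_ltn ltnS (ltnW im) orbT.
apply: le_trans (svd_max sf h) _; rewrite -[leRHS]mulr1 ler_wpM2l ?nsq_ge0//.
exact: svd_nsq_le1 sf.
Qed.

Lemma svd_ker T f x : svd T f -> linear T -> (forall n, dot x (f n) = 0) -> T x = 0.
Proof.
move=> sf lT h; apply/eqP; rewrite -(nsq_eq0 dot); apply/eqP.
apply: (@small_eq0 _ _ (nsq x)) => e /(svd_to0 sf)[n hn].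
rewrite ger0_norm ?nsq_ge0//; have hx : forall i, (i < n)%N -> dot x (f i) = 0 by [].
apply: le_trans (svd_max sf hx) _; rewrite ler_wpM2r ?nsq_ge0//; exact: ltW.
Qed.

End SingularValues.

(** * Comparison of singular values *)

Section Comparison.
Context {R : realType} {H : completeNormedModType R[i]}.
Variable dot : {dot H for Num.conj}.
Hypothesis Hnorm : hilbert_norm dot.
Local Notation nm := (hnorm dot).
Local Notation nsq := (hnormsq dot).
Local Notation rdot := (redot dot).
Local Notation adj := (adjoint dot).
Local Notation svd := (svd dot).
Implicit Types (x y z : H) (T X : H -> H) (f e : nat -> H).

Lemma dot_suml n (e : 'I_n -> H) y : dot (\sum_(i < n) e i) y = \sum_(i < n) dot (e i) y.
Proof. by apply: (big_morph (dot^~ y)) => [u v|]; [exact: dotDl|exact: dot0l]. Qed.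
Lemma rdot_suml n (e : 'I_n -> H) y : rdot (\sum_(i < n) e i) y = \sum_(i < n) rdot (e i) y.
Proof. by apply: (big_morph (rdot^~ y)) => [u v|]; [exact: rdotDl|exact: rdot0l]. Qed.

Lemma pythagoras n (e : 'I_n -> H) : (forall i j, i != j -> rdot (e i) (e j) = 0) ->
  nsq (\sum_(i < n) e i) = \sum_(i < n) nsq (e i).
Proof.
elim: n e => [|n IH] e he; first by rewrite !big_ord0 nsq0.
rewrite !big_ord_recr /= nsqD IH => [|i j ij]; last by apply: he; rewrite -val_eqE.
rewrite rdot_suml [X in 2 * X]big1 ?mulr0 ?addr0// => i _; apply: he.
by rewrite neq_ltn /= ltn_ord.
Qed.

Lemma orth_combination n m (e : 'I_n -> H) (g : 'I_m -> H) X : (m < n)%N -> linear X ->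
  exists c : 'I_n -> R[i], (exists i, c i != 0) /\
    forall j, dot (X (\sum_(i < n) c i *: e i)) (g j) = 0.
Proof.
move=> mn lX; pose A : 'M[R[i]]_(n, m) := \matrix_(i, j) dot (X (e i)) (g j).
have : kermx A != 0.
  rewrite -mxrank_eq0 mxrank_ker subn_eq0 -ltnNge.
  by rewrite (leq_ltn_trans _ mn)// rank_leq_col.
move=> /rowV0Pn[v /sub_kermxP vA v0]; exists (v 0); split.
  apply: contrapT => /forallNP h; move/negP: v0; apply; apply/eqP/rowP => i.
  by rewrite mxE; apply: contrapT => /eqP/h.
move=> j; rewrite (lin_sum _ lX) dot_suml.
have /matrixP/(_ 0 j) := vA; rewrite !mxE => E; rewrite -[RHS]E; apply: eq_bigr => i _.
by rewrite (linZ lX) dotZl mxE.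
Qed.

Lemma nsq_eigen T x (l : R) : bounded_op T -> adj T (T x) = l%:C *: x -> nsq (T x) = l * nsq x.
Proof. by move=> bT h; rewrite /hnormsq (rdot_adj Hnorm _ _ bT) h rdotZr. Qed.

Lemma eigenZ T x (l : R) (c : R[i]) : bounded_op T -> adj T (T x) = l%:C *: x ->
  adj T (T (c *: x)) = l%:C *: (c *: x).
Proof.
move=> bT h; rewrite (linZ (bop_linear bT)) (linZ (bop_linear (bop_adj Hnorm bT))) h.
by rewrite !scalerA mulrC.
Qed.

Lemma rdot_eigen T x y (l : R) : bounded_op T -> adj T (T x) = l%:C *: x ->
  rdot (T x) (T y) = l * rdot x y.
Proof. by move=> bT h; rewrite rdotC (rdot_adj Hnorm _ _ bT) h rdotZr rdotC. Qed.

(** Min-max: some nonzero [y] in the span of [f' 0, ..., f' n] has [X y] orthogonal to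
    [f 0, ..., f n.-1]. The map [X] covers both domination ([X] the identity, [k = 1]) and
    composition with a bounded operator. *)
Lemma svd_compare T f T' f' X (k : R) : bounded_op T -> svd T f ->
  bounded_op T' -> svd T' f' -> linear X -> 0 <= k ->
  (forall x, nsq (T' x) <= nsq (T (X x))) -> (forall x, nsq (X x) <= k * nsq x) ->
  forall n, nsq (T' (f' n)) <= k * nsq (T (f n)).
Proof.
move=> bT sf bT' sf' lX k0 hT hX n.
have [l0|] := lerP (nsq (T' (f' n))) 0.
  by apply: le_trans l0 _; rewrite mulr_ge0 ?nsq_ge0.
move=> l0; have [c [[i0 ci] hc]] := orth_combination (fun i : 'I_n.+1 => f' i)
  (fun i : 'I_n => f i) (ltnSn n) lX.
pose y := \sum_(i < n.+1) c i *: f' i.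
have orth (i j : 'I_n.+1) : i != j -> rdot (c i *: f' i) (c j *: f' j) = 0.
  by move=> ij; rewrite /redot dotZl dotZr (svd_orth sf')// !mulr0.
have yE : nsq y = \sum_(i < n.+1) nsq (c i *: f' i) by exact: pythagoras.
have eig i : adj T' (T' (c i *: f' (i : 'I_n.+1))) = (nsq (T' (f' i)))%:C *: (c i *: f' i).
  by apply: eigenZ => //; exact: svd_eigen sf' _.
have TyE : nsq (T' y) = \sum_(i < n.+1) nsq (T' (f' i)) * nsq (c i *: f' i).
  rewrite /y (lin_sum _ (bop_linear bT')) pythagoras => [|i j ij].
    by apply: eq_bigr => i _; rewrite (nsq_eigen bT' (eig i)).
  by rewrite (rdot_eigen _ bT' (eig i)) orth// mulr0.
(* The [n]-th value being positive, the earlier ones are too, so every [f' i] involved is a unit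
   vector. *)
have y0 : 0 < nsq y.
  rewrite lt_def nsq_ge0 andbT yE psumr_neq0; last by move=> *; exact: nsq_ge0.
  apply/hasP; exists i0; first exact: mem_index_enum.
  rewrite /= lt_def nsq_ge0 andbT nsq_eq0 scaler_eq0 (negbTE ci) /= -(nm_eq0 dot).
  by rewrite (svd_nm sf') (lt_le_trans l0 (svd_decr sf' _)) ?oner_eq0// -ltnS.
have h1 : nsq (T' (f' n)) * nsq y <= nsq (T' y).
  rewrite yE TyE mulr_sumr; apply: ler_sum => i _.
  by rewrite ler_wpM2r ?nsq_ge0// (svd_decr sf')// -ltnS.
have h2 : nsq (T (X y)) <= nsq (T (f n)) * nsq (X y).
  by apply: (svd_max sf) => i ni; exact: (hc (Ordinal ni)).
have h3 : nsq (T (f n)) * nsq (X y) <= nsq (T (f n)) * (k * nsq y).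
  by rewrite ler_wpM2l ?nsq_ge0.
rewrite -(ler_pM2r y0); apply: le_trans h1 (le_trans (hT y) (le_trans h2 _)).
by apply: le_trans h3 _; rewrite mulrCA mulrA.
Qed.

Definition sqc (c : R[i]) : R := complex.Re c ^+ 2 + complex.Im c ^+ 2.

Lemma sqc_ge0 c : 0 <= sqc c. Proof. by rewrite addr_ge0// sqr_ge0. Qed.

Lemma sqc0 : sqc 0 = 0.
Proof. by rewrite /sqc (_ : complex.Re 0 = 0)// (_ : complex.Im 0 = 0)// expr0n addr0. Qed.

Lemma sqcJ x y : sqc (dot x y) = sqc (dot y x).
Proof. by rewrite dotC /sqc; case: (dot y x) => a b /=; rewrite sqrrN. Qed.

Lemma nsqZ_sqc c x : nsq (c *: x) = sqc c * nsq x.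
Proof. by apply: complexI; rewrite nsqZc -add_Re2_Im2 rmorphM. Qed.

Lemma rdot_proj x y : rdot x (dot x y *: y) = sqc (dot x y).
Proof. by rewrite /redot dotZr /sqc; case: (dot x y) => a b /=; ring. Qed.

(** Norms at most 1 are allowed because singular vectors may be zero. *)
Lemma bessel n (e : 'I_n -> H) x : (forall i j, i != j -> dot (e i) (e j) = 0) ->
  (forall i, nsq (e i) <= 1) -> \sum_(i < n) sqc (dot x (e i)) <= nsq x.
Proof.
move=> he e1.
have := nsq_ge0 dot (x - \sum_(i < n) dot x (e i) *: e i).
rewrite nsqB rdotC rdot_suml.
have -> : \sum_(i < n) rdot (dot x (e i) *: e i) x = \sum_(i < n) sqc (dot x (e i)).
  by apply: eq_bigr => i _; rewrite rdotC rdot_proj.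
rewrite pythagoras => [|i j ij]; last by rewrite /redot dotZl dotZr he// !mulr0.
have : \sum_(i < n) nsq (dot x (e i) *: e i) <= \sum_(i < n) sqc (dot x (e i)).
  apply: ler_sum => i _; rewrite nsqZ_sqc -[leRHS]mulr1.
  by rewrite ler_wpM2l ?sqc_ge0.
lra.
Qed.

Lemma svd_residual T f N x : svd T f ->
  forall j, (j < N)%N -> dot (x - \sum_(i < N) dot x (f i) *: f i) (f j) = 0.
Proof.
move=> sf j jN; rewrite dotDl dotNl dot_suml (bigD1 (Ordinal jN))//= big1 ?addr0.
  rewrite dotZl dot_nsq (svd_nsq j sf); case: (boolP (0 < _)) => h.
    by rewrite mulr1 subrr.
  have -> : f j = 0 by apply/eqP; rewrite -(nm_eq0 dot) (svd_nm sf) (negbTE h).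
  by rewrite linear0r mul0r subrr.
move=> i ij; rewrite dotZl (svd_orth sf) ?mulr0//.
Qed.

(** The first [N] directions are diagonal and the remainder is bounded by the [N]-th value.
    Subtracting that value from the others leaves nonnegative weights on the coefficients of [x]. *)
Lemma svd_bound T f N x : bounded_op T -> svd T f ->
  nsq (T x) <= nsq (T (f N)) * nsq x
    + \sum_(j < N) (nsq (T (f j)) - nsq (T (f N))) * sqc (dot x (f j)).
Proof.
move=> bT sf; have lT := bop_linear bT.
pose s := \sum_(i < N) dot x (f i) *: f i; pose z := x - s.
have zf := svd_residual (N := N) x sf.
have eig i : adj T (T (dot x (f i) *: f i)) = (nsq (T (f i)))%:C *: (dot x (f i) *: f i).
  by apply: eigenZ => //; exact: svd_eigen sf _.
have orth (i j : 'I_N) : i != j -> rdot (dot x (f i) *: f i) (dot x (f j) *: f j) = 0.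
  by move=> ij; rewrite /redot dotZl dotZr (svd_orth sf)// !mulr0.
have term i : nsq (dot x (f i) *: f i) = sqc (dot x (f i)).
  rewrite nsqZ_sqc (svd_nsq i sf); case: (boolP (0 < _)) => h; rewrite ?mulr1//.
  have -> : f i = 0 by apply/eqP; rewrite -(nm_eq0 dot) (svd_nm sf) (negbTE h).
  by rewrite [dot x 0]linear0r sqc0 mul0r.
have sE : nsq s = \sum_(i < N) sqc (dot x (f i)).
  by rewrite pythagoras//; apply: eq_bigr.
have TsE : nsq (T s) = \sum_(i < N) nsq (T (f i)) * sqc (dot x (f i)).
  rewrite /s (lin_sum _ lT) pythagoras => [|i j ij].
    by apply: eq_bigr => i _; rewrite (nsq_eigen bT (eig i)) term.
  by rewrite (rdot_eigen _ bT (eig i)) orth// mulr0.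
have zs : rdot s z = 0.
  rewrite rdot_suml big1// => i _; rewrite /redot dotZl (dotC _ (f i)) zf//.
  by rewrite rmorph0 mulr0.
have Tzs : rdot (T s) (T z) = 0.
  rewrite /s (lin_sum _ lT) rdot_suml big1// => i _.
  rewrite (rdot_eigen _ bT (eig i)) /redot dotZl (dotC _ (f i)) zf//.
  by rewrite rmorph0 mulr0 mulr0.
have xE : x = s + z by rewrite /z addrC subrK.
have nx : nsq x = nsq s + nsq z by rewrite {1}xE nsqD zs mulr0 addr0.
have -> : nsq (T x) = nsq (T s) + nsq (T z).
  by rewrite {1}xE (linD lT) nsqD Tzs mulr0 addr0.
have hz := svd_max sf zf; rewrite -/z in hz.
have -> : \sum_(j < N) (nsq (T (f j)) - nsq (T (f N))) * sqc (dot x (f j)) =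
    nsq (T s) - nsq (T (f N)) * nsq s.
  by rewrite TsE sE mulr_sumr -sumrB; apply: eq_bigr => i _; rewrite mulrBl.
rewrite nx; lra.
Qed.

(** Summing [svd_bound] over the family and exchanging sums, Bessel bounds the total weight of each
    [f j] by 1. *)
Lemma ky_fan T f N (e : 'I_N -> H) : bounded_op T -> svd T f ->
  (forall i j, i != j -> dot (e i) (e j) = 0) -> (forall i, nsq (e i) <= 1) ->
  \sum_(i < N) nsq (T (e i)) <= \sum_(j < N) nsq (T (f j)).
Proof.
move=> bT sf he e1.
apply: (@le_trans _ _ (\sum_(i < N) (nsq (T (f N)) +
    \sum_(j < N) (nsq (T (f j)) - nsq (T (f N))) * sqc (dot (e i) (f j))))).
  apply: ler_sum => i _; apply: le_trans (svd_bound N (e i) bT sf) _.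
  by rewrite lerD2r -[leRHS]mulr1 ler_wpM2l ?nsq_ge0.
rewrite big_split /= exchange_big -big_split /=; apply: ler_sum => j _.
rewrite -mulr_sumr -lerBrDl -[leRHS]mulr1 ler_wpM2l ?subr_ge0 ?(svd_decr sf (ltnW (ltn_ord j)))//.
apply: le_trans (svd_nsq_le1 j sf); under eq_bigr do rewrite sqcJ.
exact: bessel.
Qed.

(** A null vector of the nonnegative form [nsq (T x) - nsq (T' x)] belongs to its radical: otherwise
    the form would be affine and nonconstant along [v], hence somewhere negative. *)
Lemma form_null T T' v x : linear T -> linear T' -> (forall x, nsq (T' x) <= nsq (T x)) ->
  nsq (T' v) = nsq (T v) -> nsq (T (x - v)) - nsq (T' (x - v)) = nsq (T x) - nsq (T' x).
Proof.
move=> lT lT' h hv; pose b := rdot (T x) (T v) - rdot (T' x) (T' v).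
have E (t : R) : nsq (T (x - t%:C *: v)) - nsq (T' (x - t%:C *: v)) =
    nsq (T x) - nsq (T' x) - 2 * t * b.
  by rewrite (linB lT) (linB lT') (linZ lT) (linZ lT') !nsqB !nsqZ !rdotZr hv /b; ring.
have -> : x - v = x - 1%:C *: v by rewrite scale1r.
rewrite E; suff -> : b = 0 by rewrite mulr0 subr0.
apply/eqP; apply: contrapT => /negP b0.
(* At this parameter the affine function takes the value -1. *)
have := h (x - ((nsq (T x) - nsq (T' x) + 1) / (2 * b))%:C *: v).
rewrite -subr_ge0 E.
have -> : 2 * ((nsq (T x) - nsq (T' x) + 1) / (2 * b)) * b = nsq (T x) - nsq (T' x) + 1.
  by field.
lra.
Qed.

(* Ky Fan's inequality for the family [f'] forces [T^* T = T'^* T'] on it; applied to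
   [f'] and a residual vector it bounds [T] on the complement of its span. *)
Lemma svd_rigidity T f T' f' : bounded_op T -> svd T f -> bounded_op T' -> svd T' f' ->
  (forall x, nsq (T' x) <= nsq (T x)) ->
  (forall n, nsq (T' (f' n)) = nsq (T (f n))) -> forall x, nsq (T' x) = nsq (T x).
Proof.
move=> bT sf bT' sf' h hs x; have lT := bop_linear bT; have lT' := bop_linear bT'.
have orth' n (i j : 'I_n) : i != j -> dot (f' i) (f' j) = 0 by exact: (svd_orth sf').
have q0 i : nsq (T' (f' i)) = nsq (T (f' i)).
  have K := ky_fan (N := i.+1) (e := fun j => f' j) bT sf (@orth' _) (fun j => svd_nsq_le1 j sf').
  have K' : \sum_(j < i) nsq (T' (f' j)) <= \sum_(j < i) nsq (T (f' j)) by exact: ler_sum.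
  have E : \sum_(j < i.+1) nsq (T (f j)) = \sum_(j < i.+1) nsq (T' (f' j)).
    by apply: eq_bigr => j _; rewrite hs.
  rewrite E !big_ord_recr /= in K; have := h (f' i); lra.
pose z N := x - \sum_(i < N) dot x (f' i) *: f' i.
have qz N : nsq (T (z N)) - nsq (T' (z N)) = nsq (T x) - nsq (T' x).
  rewrite /z; elim: N => [|N IH]; first by rewrite big_ord0 subr0.
  rewrite big_ord_recr /= opprD addrA form_null//.
  by rewrite (linZ lT) (linZ lT') !nsqZ_sqc q0.
have nz N : nsq (z N) <= nsq x.
  have E : rdot (x - z N) (z N) = 0.
    rewrite /z opprB addrC subrK -/(z N) rdot_suml big1// => i _.
    by rewrite /redot dotZl (dotC _ (f' i)) (svd_residual x sf')// rmorph0 mulr0.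
  have nxE : nsq x = nsq (x - z N + z N) by rewrite subrK.
  by rewrite nxE nsqD E mulr0 addr0 lerDr nsq_ge0.
have Tz N : nsq (T (z N)) <= nsq (T (f N)) * nsq x.
  have [z0|z0] := eqVneq (z N) 0.
    by rewrite z0 (lin0 lT) nsq0 mulr_ge0 ?nsq_ge0.
  have zp : 0 < nsq (z N) by rewrite lt_def nsq_eq0 z0 nsq_ge0.
  pose w := (nm (z N))^-1%:C *: z N.
  (* In Ky Fan's inequality for [N.+1] vectors the first [N] terms on both sides cancel by [q0] and
     [hs], leaving [nsq (T w) <= nsq (T (f N))]. *)
  pose e (i : 'I_N.+1) := if (i < N)%N then f' i else w.
  have wf j : (j < N)%N -> dot w (f' j) = 0.
    by move=> jN; rewrite dotZl (svd_residual x sf')// mulr0.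
  have he (i j : 'I_N.+1) : i != j -> dot (e i) (e j) = 0.
    move=> ij; rewrite /e; case: ifPn => iN; case: ifPn => jN.
    - exact: (svd_orth sf').
    - by rewrite dotC wf// rmorph0.
    - exact: wf.
    - have last_ord (k : 'I_N.+1) : ~~ (k < N)%N -> k = ord_max.
        by rewrite -leqNgt => Nk; apply: val_inj; apply/eqP; rewrite eqn_leq Nk -ltnS ltn_ord.
      by move: ij; rewrite (last_ord _ iN) (last_ord _ jN) eqxx.
  have e1 i : nsq (e i) <= 1.
    rewrite /e; case: ifPn => _; first exact: svd_nsq_le1 sf'.
    by rewrite nsqZ exprVn sqr_nm mulVf// gt_eqF.
  have := ky_fan bT sf he e1; rewrite !big_ord_recr /= /e ltnn.
  under eq_bigr => i _ do rewrite /= ltn_ord -q0 hs.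
  rewrite lerD2l (linZ lT) nsqZ exprVn sqr_nm mulrC ler_pdivrMr// => /le_trans; apply.
  by rewrite ler_wpM2l ?nsq_ge0.
apply/eqP; rewrite eq_sym -subr_eq0; apply/eqP.
apply: (@small_eq0 _ _ (nsq x)) => r r0.
rewrite ger0_norm ?subr_ge0//; have [N hN] := svd_to0 sf r0.
rewrite -(qz N); have := Tz N; have := nsq_ge0 dot (T' (z N)).
have := ler_wpM2r (nsq_ge0 dot x) (ltW hN); lra.
Qed.

End Comparison.

(** * The Schatten sum in terms of singular values *)

Section SchattenSum.
Context {R : realType} {H : completeNormedModType R[i]}.
Variable dot : {dot H for Num.conj}.
Hypothesis Hnorm : hilbert_norm dot.
Local Notation nm := (hnorm dot).
Local Notation nsq := (hnormsq dot).
Local Notation rdot := (redot dot).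
Local Notation adj := (adjoint dot).
Local Notation svd := (svd dot).
Implicit Types (x y z : H) (T X : H -> H) (f e : nat -> H).

Lemma realC_eq0 (r : R) : (r%:C == 0 :> R[i]) = (r == 0).
Proof. by rewrite eq_complex /= eqxx andbT. Qed.

(** For the converse, [z = |T| x - l x] satisfies [|T| z = - l z], and positivity of [|T|] with
    [0 < l] forces [z = 0]. *)
Lemma op_abs_eigen T x (l : R) : bounded_op T -> 0 < l ->
  (op_abs dot T x = l%:C *: x) <-> (adj T (T x) = (l ^+ 2)%:C *: x).
Proof.
move=> bT l0; have [pA AA] := op_absP Hnorm bT; have lA := bop_linear pA.1.
split=> h; first by rewrite -AA h (linZ lA) h scalerA -rmorphM.
pose z := op_abs dot T x - l%:C *: x.
have zE : op_abs dot T z = (- l)%:C *: z.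
  rewrite /z (linB lA) (linZ lA) AA h scalerBr scalerA -rmorphM mulNr -expr2 !rmorphN.
  by rewrite !scaleNr opprK addrC.
have := pos_op_ge0 z pA; rewrite zE rdotZl -/(nsq z) => h1.
have h2 := nsq_ge0 dot z.
have : nsq z = 0 by apply/eqP; rewrite eq_le h2 andbT; nra.
by move/eqP; rewrite nsq_eq0 subr_eq0 => /eqP.
Qed.

(** [J] is finite because the values tend to 0. More than [size J] independent eigenvectors would
    yield a nonzero eigenvector orthogonal to every [f m]: by dimension for [m] in [J], by distinct
    eigenvalues otherwise. Such a vector lies in the kernel of [T], contradicting [0 < l]. *)
Lemma multiplicity_svd T f (l : R) : bounded_op T -> svd T f -> 0 < l ->
  exists2 J : seq nat, uniq J & (forall n, (n \in J) = (nm (T (f n)) == l)) /\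
    multiplicity (op_abs dot T) l = (size J)%:R%:E.
Proof.
move=> bT sf l0; have lT := bop_linear bT.
have [N hN] := svd_to0 sf (exprn_gt0 2 l0).
pose J := [seq n <- iota 0 N | nm (T (f n)) == l].
have JE n : (n \in J) = (nm (T (f n)) == l).
  rewrite mem_filter mem_iota /= add0n; apply: andb_idr => /eqP e.
  rewrite ltnNge; apply/negP => Nn; have := svd_decr sf Nn.
  by rewrite -[nsq (T (f n))]sqr_nm e leNgt hN.
have uJ : uniq J by rewrite filter_uniq ?iota_uniq.
exists J => //; split => //.
apply/eqP; rewrite eq_le; apply/andP; split.
  apply: ge_ereal_sup => _ [n [e [le he]] <-]; rewrite lee_fin ler_nat leqNgt.
  apply/negP => Jn.
  have lid : linear (@id H) by [].
  have [c [[i0 ci] hc]] := orth_combination dot e (fun j : 'I_(size J) => f (nth 0%N J j)) Jn lid.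
  pose y := \sum_(i < n) c i *: e i; rewrite -/y in hc.
  have y0 : y <> 0 by move=> /le /(_ i0) /eqP; rewrite (negbTE ci).
  have ey : adj T (T y) = (l ^+ 2)%:C *: y.
    apply/(op_abs_eigen _ bT l0); have [pA _] := op_absP Hnorm bT.
    rewrite /y (lin_sum _ (bop_linear pA.1)) scaler_sumr; apply: eq_bigr => i _.
    by rewrite (linZ (bop_linear pA.1)) he !scalerA mulrC.
  have yf m : dot y (f m) = 0.
    have [|mJ] := boolP (m \in J).
      by move=> mJ; have := hc (Ordinal (etrans (index_mem m J) mJ)); rewrite /= nth_index.
    have := dot_adjl Hnorm (T y) (f m) bT; rewrite (dot_adj Hnorm _ _ bT) (svd_eigen sf) ey.
    rewrite dotZl dotZr conjc_real => /eqP; rewrite -subr_eq0 -mulrBl mulf_eq0.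
    move=> /orP[|/eqP//]; rewrite -rmorphB realC_eq0 subr_eq0 => h.
    case/negP: mJ; rewrite JE; move: h; rewrite -sqr_nm.
    by rewrite eq_sym eqrXn2 ?nm_ge0// ltW.
  apply: y0; have := svd_ker sf lT yf => Ty; move: ey.
  rewrite Ty (lin0 (bop_linear (bop_adj Hnorm bT))) => /esym/eqP.
  rewrite scaler_eq0 => /orP[|/eqP//].
  by rewrite realC_eq0 expf_eq0 /= gt_eqF.
apply: ereal_sup_ubound; exists (size J) => //.
exists (fun i => f (nth 0%N J i)); split=> [c hc i|i].
  have sJ (j : 'I_(size J)) : nm (T (f (nth 0%N J j))) = l.
    by apply/eqP; rewrite -JE mem_nth.
  have := congr1 (dot^~ (f (nth 0%N J i))) hc; rewrite dot0l dot_suml (bigD1 i)//=.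
  rewrite big1 ?addr0; last first.
    by move=> j ji; rewrite dotZl (svd_orth sf) ?mulr0// nth_uniq.
  rewrite dotZl dot_nsq (svd_nsq _ sf) -sqr_nm sJ exprn_gt0// mulr1 //.
apply/(op_abs_eigen _ bT l0); rewrite (svd_eigen sf) -sqr_nm.
by have := mem_nth 0%N (ltn_ord i); rewrite JE => /eqP ->.
Qed.

Local Open Scope ereal_scope.

(** Indices are grouped by singular value through the pairs [(nm (T (f n)), n)]; the indices of
    value 0 return at no cost since [0 < p]. *)
Lemma schatten_sum_svd T f (p : R) : bounded_op T -> svd T f -> (0 < p)%R ->
  schatten_sum dot p T = \esum_(n in [set: nat]) (nm (T (f n)) `^ p)%:E.
Proof.
move=> bT sf p0; rewrite /schatten_sum.
have E l : (0 < l)%R -> multiplicity (op_abs dot T) l * (l `^ p)%:E =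
    \esum_(n in [set n | nm (T (f n)) = l]) (nm (T (f n)) `^ p)%:E.
  move=> l0; have [J uJ [JE ->]] := multiplicity_svd bT sf l0.
  have -> : [set n | nm (T (f n)) = l] = [set` J].
    apply/seteqP; split => n /= h; [have : n \in J by rewrite JE h|have : n \in J by []].
      by [].
    by rewrite JE => /eqP.
  rewrite esum_fset; [|exact: finite_seq|by move=> *; rewrite lee_fin powR_ge0].
  rewrite -fsbig_seq//=.
  transitivity (\sum_(n <- J) (l `^ p)%:E); last first.
    by apply: eq_big_seq => n; rewrite JE => /eqP ->.
  by rewrite sumEFin -EFinM big_const_seq count_predT iter_addr_0 mulr_natl.
rewrite (eq_esum E) esum_esum; last by move=> *; rewrite lee_fin powR_ge0.
rewrite (reindex_esum [set n | (0 < nm (T (f n)))%R] _ (fun n => (nm (T (f n)), n))) /=; last first.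
  split=> [n /= h|m n _ _ []//|[l n] /= [l0 e]]; first by split.
  by exists n; rewrite e.
rewrite [LHS]esum_mkcond; apply: eq_esum => n _.
case: ifPn => //; rewrite notin_setE /= => /negP; rewrite -leNgt => h.
have -> : nm (T (f n)) = 0%R by apply/eqP; rewrite eq_le h nm_ge0.
by rewrite powR0// gt_eqF.
Qed.

Lemma precompact_comp S X : precompact_op dot S -> bounded_op X -> precompact_op dot (S \o X).
Proof.
move=> [bS [K cK SK]] bX; split; first exact: (bop_comp Hnorm).
have [k k0 hk] := bop_bound Hnorm bX.
have k1 : (0 < k + 1)%R by rewrite ltr_wpDl.
exists ((fun y => (k + 1)%:C *: y) @` K).
  apply: continuous_compact => //; apply: continuous_subspaceT.
  exact: scaler_continuous.
move=> x x1; exists (S (((k + 1)^-1)%:C *: X x)).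
  apply: SK; rewrite nmZ ger0_norm ?invr_ge0 ?(ltW k1)// mulrC ler_pdivrMr// mul1r.
  rewrite (le_trans (hk x))// (@le_trans _ _ k)// ?lerDl//.
  by rewrite -[leRHS]mulr1 ler_wpM2l.
by rewrite (linZ (bop_linear bS)) scalerA -rmorphM divff ?gt_eqF// scale1r.
Qed.

Lemma schatten_precompact p T : schatten_class dot p T -> precompact_op dot T.
Proof.
move=> [[bT cT] _]; split => //; exists (closure (T @` [set x | (`|x| <= 1)%R])) => // x x1.
apply: subset_closure; exists x => //=; rewrite (norm_nm Hnorm) lecE /= eqxx.
by rewrite x1.
Qed.

Lemma le_schatten_sum T T' p : (0 < p)%R -> precompact_op dot T -> precompact_op dot T' ->
  (forall x, nsq (T' x) <= nsq (T x))%R -> schatten_sum dot p T' <= schatten_sum dot p T.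
Proof.
move=> p0 cT cT' h.
have [f sf] := svd_exists Hnorm cT; have [f' sf'] := svd_exists Hnorm cT'.
rewrite (schatten_sum_svd cT.1 sf p0) (schatten_sum_svd cT'.1 sf' p0).
apply: le_esum => n _; rewrite lee_fin ge0_ler_powR ?nnegrE ?nm_ge0 ?(ltW p0)//.
rewrite le_nm -[leRHS]mul1r; apply: (svd_compare Hnorm cT.1 sf cT'.1 sf' (X := id)) => //.
by move=> x; rewrite mul1r.
Qed.

Lemma schatten_sum_comp_fin S X p : (0 < p)%R -> precompact_op dot S -> bounded_op X ->
  schatten_sum dot p S < +oo -> schatten_sum dot p (S \o X) < +oo.
Proof.
move=> p0 cS bX; have cSX := precompact_comp cS bX.
have [f sf] := svd_exists Hnorm cS; have [f' sf'] := svd_exists Hnorm cSX.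
rewrite (schatten_sum_svd cS.1 sf p0) (schatten_sum_svd cSX.1 sf' p0) => hS.
have [k k0 hk] := bop_bound Hnorm bX.
have hk2 x : (nsq (X x) <= k ^+ 2 * nsq x)%R.
  by rewrite -!sqr_nm -exprMn ler_sqr ?nnegrE ?mulr_ge0 ?nm_ge0.
have h n : (nm (S (X (f' n))) <= k * nm (S (f n)))%R.
  rewrite -ler_sqr ?nnegrE ?mulr_ge0 ?nm_ge0// exprMn !sqr_nm.
  exact: (svd_compare Hnorm cS.1 sf cSX.1 sf' (bop_linear bX) (sqr_ge0 k) _ hk2 n).
apply: (@le_lt_trans _ _ ((k `^ p)%:E * \esum_(n in [set: nat]) (nm (S (f n)) `^ p)%:E)).
  rewrite -!nneseries_esumT; try by move=> *; rewrite lee_fin powR_ge0.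
  rewrite -nneseriesZl; last by move=> *; rewrite lee_fin powR_ge0.
  apply: lee_nneseries => n _; first by rewrite lee_fin powR_ge0.
  rewrite -EFinM lee_fin -powRM ?nm_ge0//.
  by rewrite ge0_ler_powR ?nnegrE ?mulr_ge0 ?nm_ge0 ?(ltW p0)//; exact: h.
rewrite -ge0_fin_numE.
  rewrite fin_numM// ge0_fin_numE//.
  by apply: esum_ge0 => *; rewrite lee_fin powR_ge0.
by rewrite mule_ge0 ?lee_fin ?powR_ge0//; apply: esum_ge0 => *; rewrite lee_fin powR_ge0.
Qed.

(** The singular values are ordered termwise; a strict inequality at [n] would remain after
    cancelling the other terms, which form a finite sum. All values thus agree and [svd_rigidity]
    applies. *)
Lemma schatten_sum_eq T T' p : (0 < p)%R -> precompact_op dot T -> precompact_op dot T' ->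
  (forall x, nsq (T' x) <= nsq (T x))%R -> schatten_sum dot p T < +oo ->
  schatten_sum dot p T <= schatten_sum dot p T' -> forall x, nsq (T' x) = nsq (T x).
Proof.
move=> p0 cT cT' h.
have [f sf] := svd_exists Hnorm cT; have [f' sf'] := svd_exists Hnorm cT'.
rewrite (schatten_sum_svd cT.1 sf p0) (schatten_sum_svd cT'.1 sf' p0) => fin le.
apply: (svd_rigidity Hnorm cT.1 sf cT'.1 sf' h) => n.
have hn m : (nm (T' (f' m)) <= nm (T (f m)))%R.
  rewrite le_nm -[leRHS]mul1r; apply: (svd_compare Hnorm cT.1 sf cT'.1 sf' (X := id)) => //.
  by move=> x; rewrite mul1r.
rewrite -!sqr_nm; congr (_ ^+ 2)%R; apply/eqP; rewrite eq_le hn /= leNgt.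
apply/negP => lt; move: le fin.
have ge0 (g : nat -> R) (A : set nat) : 0 <= \esum_(n in A) (g n `^ p)%:E.
  by apply: esum_ge0 => *; rewrite lee_fin powR_ge0.
rewrite (esumID [set n] setT) ?[X in _ <= X](esumID [set n] setT); try by move=> *; rewrite lee_fin powR_ge0.
rewrite !setTI !esum_set1 ?lee_fin ?powR_ge0// => le fin.
have r1 : \esum_(i in ~` [set n]) (nm (T' (f' i)) `^ p)%:E <=
    \esum_(i in ~` [set n]) (nm (T (f i)) `^ p)%:E.
  by apply: le_esum => m _; rewrite lee_fin ge0_ler_powR ?nnegrE ?nm_ge0 ?(ltW p0).
have rf : \esum_(i in ~` [set n]) (nm (T (f i)) `^ p)%:E \is a fin_num.
  rewrite ge0_fin_numE//; apply: le_lt_trans fin.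
  by rewrite leeDr// lee_fin powR_ge0.
have := le_trans le (leeD2l _ r1); rewrite leeD2rE// lee_fin leNgt.
by rewrite gt0_ltr_powR ?nnegrE ?nm_ge0.
Qed.

End SchattenSum.

(** * The shorted operator and the normal equation *)

Section Shorted.
Context {R : realType} {H : completeNormedModType R[i]}.
Variable dot : {dot H for Num.conj}.
Hypothesis Hnorm : hilbert_norm dot.
Local Notation nm := (hnorm dot).
Local Notation nsq := (hnormsq dot).
Local Notation rdot := (redot dot).
Local Notation adj := (adjoint dot).
Implicit Types (x y z : H) (S T W : H -> H) (M : set H).

Lemma pos_op_eq S T : pos_op dot S -> pos_op dot T ->
  (forall x, rdot (S x) x = rdot (T x) x) -> S = T.
Proof.
move=> pS pT h; have lS := bop_linear pS.1; have lT := bop_linear pT.1.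
apply/funext => x; apply: (@rdot_inj _ _ dot) => y.
have := h (x + y); rewrite (linD lS) (linD lT) !rdotDl !rdotDr !h.
have := pos_op_rsym y x pS; have := pos_op_rsym y x pT.
rewrite !(rdotC _ y); lra.
Qed.

(** Residuals of equal pointwise norm thereby have the same [op_abs], hence the same Schatten
    sum. *)
Lemma adj_comp_eq S T : bounded_op S -> bounded_op T ->
  (forall x, nsq (S x) = nsq (T x)) -> adj S \o S = adj T \o T.
Proof.
move=> bS bT h; apply: pos_op_eq; try exact: pos_adjK.
move=> x /=; rewrite ![rdot (adj _ _) _]rdotC -(rdot_adj Hnorm _ _ bS) -(rdot_adj Hnorm _ _ bT).
exact: h.
Qed.

Lemma op_le_rdot S T : pos_op dot S -> pos_op dot T ->
  op_le dot S T <-> forall x, rdot (S x) x <= rdot (T x) x.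
Proof.
move=> pS pT; split=> [[_ h] x|h]; rewrite /op_le.
  by have /dot_ge0[+ _] := h x; rewrite /= rdotBl subr_ge0.
split; first by apply: bop_sub; [exact: pT.1|exact: pS.1].
move=> x; apply/dot_ge0; rewrite /= !rdotBl subr_ge0; split; first exact: h.
have /dot_ge0[_ ->] := pS.2 x; have /dot_ge0[_ ->] := pT.2 x.
by rewrite subrr.
Qed.

Lemma proj_unique M (P : H -> H) v m w : subspace M ->
  (forall x, closure M (P x)) -> (forall x m, closure M m -> dot (x - P x) m = 0) ->
  closure M m -> (forall u, closure M u -> dot w u = 0) -> v = m + w -> v - P v = w.
Proof.
move=> sM cP oP cm ow ->; have sC := subspace_closure Hnorm sM.
set t := m + w - _; have wE : w - t = P (m + w) - m by rewrite /t; vector_ring dot.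
apply/esym/eqP; rewrite -subr_eq0 -(dnorm_eq0 dot).
have ct : closure M (w - t) by rewrite wE; apply: (subspaceB sC).
by rewrite dotDl dotNl ow// oP// subrr.
Qed.

(** Maximality of [V (1 - P) V]: a competitor [Y] vanishes against [range A] on both sides, so its
    form at [x] equals its form at [x - A a], hence is at most [nsq (V x - V (A a))]; the infimum
    over [a] is [nsq (V x - P (V x))]. *)
Lemma shorted_proj W V A (P : H -> H) : pos_op dot W -> pos_op dot V -> (forall x, V (V x) = W x) ->
  bounded_op A -> bounded_op P -> (forall x, closure (range (V \o A)) (P x)) ->
  (forall x m, closure (range (V \o A)) m -> dot (x - P x) m = 0) ->
  pos_op dot (shorted dot W (range A)) /\
  forall x, rdot (shorted dot W (range A) x) x = nsq (V x - P (V x)).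
Proof.
move=> pW pV VV bA bP cP oP.
pose S x := V (V x - P (V x)).
have lV := bop_linear pV.1; have lA := bop_linear bA.
have SE x y : dot (S x) y = dot (V x - P (V x)) (V y - P (V y)).
  rewrite /S (pos_op_sym _ _ pV) -[in LHS](subrK (P (V y)) (V y)) linearDr/=.
  by rewrite (oP _ _ (cP _)) addr0.
have bS : bounded_op S.
  have := bop_comp Hnorm pV.1 (bop_sub pV.1 (bop_comp Hnorm bP pV.1)).
  by [].
have pS : pos_op dot S by split => // x; rewrite SE dnorm_ge0.
have Sx x : rdot (S x) x = nsq (V x - P (V x)) by rewrite /redot SE.
have S_A x a : dot (S x) (A a) = 0.
  rewrite /S (pos_op_sym _ _ pV) oP//; apply: subset_closure.
  by exists a.
pose ok := [set Y : H -> H | [/\ bounded_op Y, op_le dot (fun=> 0) Y, op_le dot Y W &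
  range Y `<=` perp dot (range A)]].
have p0 : pos_op dot (fun=> 0 : H).
  by split; [exact: bop0 Hnorm|move=> x; rewrite dot0l].
have okpos Y : ok Y -> pos_op dot Y.
  move=> [bY [_ h] _ _]; split=> // x; have := h x.
  by rewrite /= subr0.
have okS : ok S.
  split=> //.
  - by apply/op_le_rdot => // x; rewrite rdot0l Sx nsq_ge0.
  - apply/op_le_rdot => // x; rewrite Sx -VV (pos_op_rsym _ _ pV) -/(nsq _).
    have nE : nsq (V x) = nsq (V x - P (V x) + P (V x)) by rewrite subrK.
    have o : rdot (V x - P (V x)) (P (V x)) = 0 by rewrite /redot oP.
    by rewrite nE (nsqD _ (V x - P (V x))) o mulr0 addr0 lerDl nsq_ge0.
  - by move=> _ [x _ <-] _ [a _ <-].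
have maxS Y : ok Y -> op_le dot Y S.
  move=> okY; have pY := okpos _ okY; have [bY _ YW Yp] := okY.
  have lY := bop_linear bY.
  apply/op_le_rdot => // x; rewrite Sx.
  have key a : rdot (Y x) x <= nsq (V x - V (A a)).
    have YA z b : rdot (Y z) (A b) = 0.
      by rewrite /redot Yp//; exists z.
    have -> : rdot (Y x) x = rdot (Y (x - A a)) (x - A a).
      rewrite rdotBr YA subr0 (linB lY) rdotBl.
      by rewrite (pos_op_rsym (A a) x pY) [rdot (A a) _]rdotC YA subr0.
    have /op_le_rdot h := YW; apply: le_trans (h pY pW (x - A a)) _.
    by rewrite -VV (pos_op_rsym _ _ pV) (linB lV).
  apply/ler_addgt0Pr => e e0.
  pose n0 := nm (V x - P (V x)).
  (* Chosen so that [d <= 1] and [(n0 + d) ^+ 2 <= n0 ^+ 2 + d * (2 * n0 + 1) <= n0 ^+ 2 + e]. *)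
  pose d := e / (2 * n0 + 1 + e).
  have n00 : 0 <= n0 by exact: nm_ge0.
  have dp : 0 < 2 * n0 + 1 + e by lra.
  have d0 : 0 < d by rewrite divr_gt0.
  have d1 : d <= 1 by rewrite ler_pdivrMr// mul1r; lra.
  have /(closure_nm Hnorm)/(_ _ d0)[_ [a _ <-] ha] := cP (V x).
  apply: le_trans (key a) _.
  have h1 : nm (V x - V (A a)) <= n0 + d.
    by apply: le_trans (nm_dist dot _ (P (V x)) _) _; rewrite lerD2l ltW.
  have h2 : nsq (V x - V (A a)) <= (n0 + d) ^+ 2.
    by rewrite -sqr_nm ler_sqr ?nnegrE ?nm_ge0 ?addr_ge0// ltW.
  have h3 : d * (2 * n0 + 1 + e) = e by rewrite divfK// gt_eqF.
  rewrite -(sqr_nm dot (V x - P (V x))) -/n0; nra.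
have -> : shorted dot W (range A) = S; last by [].
rewrite /shorted; case: xgetP => [U _ [okU mU]|/(_ S) []]; last by split.
apply: pos_op_eq => //; first exact: okpos.
move=> x; apply/eqP; rewrite eq_le; apply/andP; split.
  by have /op_le_rdot h := maxS _ okU; apply: h => //; exact: okpos.
by have /op_le_rdot h := mU _ okS; apply: h => //; exact: okpos.
Qed.

End Shorted.

(** * The normal equation and descent *)

Section NormalEquation.
Context {R : realType} {H : completeNormedModType R[i]}.
Variable dot : {dot H for Num.conj}.
Hypothesis Hnorm : hilbert_norm dot.
Local Notation nm := (hnorm dot).
Local Notation nsq := (hnormsq dot).
Local Notation rdot := (redot dot).
Local Notation adj := (adjoint dot).
Variables A B C V : H -> H.
Hypotheses (bA : bounded_op A) (bB : bounded_op B) (bC : bounded_op C) (pV : pos_op dot V).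
Implicit Types (x y z h : H) (X Y : H -> H).

Local Notation res X := ((A \o X \o B) \- C).

Lemma bop_res X : bounded_op X -> bounded_op (res X).
Proof.
by move=> bX; apply: bop_sub => //; apply: (bop_comp Hnorm) => //; exact: (bop_comp Hnorm).
Qed.

Lemma normal_eq_min X0 X h : (forall h, adj A (V (V (res X0 h))) = 0) ->
  nsq (V (res X0 h)) <= nsq (V (res X h)).
Proof.
move=> ne; have lA := bop_linear bA; have lV := bop_linear pV.1.
have -> : res X h = res X0 h + A (X (B h) - X0 (B h)).
  by rewrite (linB lA) /=; vector_ring dot.
move: (ne h); move: (res X0 h) => r neh.
rewrite (linD lV) nsqD -(pos_op_rsym _ _ pV) rdotC (rdot_adj Hnorm _ _ bA) neh rdot0r.
by rewrite mulr0 addr0 lerDl nsq_ge0.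
Qed.

(* Put [M = V A], [N] its adjoint and [T = V (A X0 B - C)]. The hypothesis on the
   nullspace of [B] makes [N T] vanish there, so [X1 = X0 - e N T B^-] satisfies
   [V (A X1 B - C) = (1 - e M N) T], a contraction of [T] for small [e]. *)
Lemma normal_eq_descent X0 : bounded_op X0 -> closed (range B) ->
  nullspace B `<=` nullspace (adj A \o (V \o V) \o C) ->
  exists X1, [/\ bounded_op X1, forall h, nsq (V (res X1 h)) <= nsq (V (res X0 h)) &
   (forall h, nsq (V (res X1 h)) = nsq (V (res X0 h))) ->
     forall h, adj A (V (V (res X0 h))) = 0].
Proof.
move=> bX0 clB NB; have lA := bop_linear bA; have lV := bop_linear pV.1.
have [D bD BDB] := closed_range_inner_inv Hnorm bB clB.
have lB := bop_linear bB; have lX0 := bop_linear bX0; have lC := bop_linear bC.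
have baA := bop_adj Hnorm bA; have laA := bop_linear baA.
have bM : bounded_op (V \o A) by exact: (bop_comp Hnorm pV.1).
have [k k0 hk] := bop_bound Hnorm bM.
(* With this step the change [- 2 * e * nsq (G h) + e ^+ 2 * k ^+ 2 * nsq (G h)] is at most
   [- e * nsq (G h)]; the added 1 keeps the denominator positive when [k = 0]. *)
pose e : R := (k ^+ 2 + 1)^-1.
have kp : 0 < k ^+ 2 + 1 by rewrite ltr_wpDl// sqr_ge0.
have e0 : 0 < e by rewrite invr_gt0.
pose G h := adj A (V (V (res X0 h))).
have bG : bounded_op G.
  have := bop_comp Hnorm baA (bop_comp Hnorm pV.1 (bop_comp Hnorm pV.1 (bop_res bX0))).
  by [].
have lG := bop_linear bG.
have GD h : G (D (B h)) = G h.
  apply/eqP; rewrite -subr_eq0 -(linB lG); apply/eqP.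
  have n0 : B (D (B h) - h) = 0 by rewrite (linB lB) BDB subrr.
  have : nullspace B (D (B h) - h) by [].
  move=> /NB; rewrite /nullspace /G /= n0 (lin0 lX0) (lin0 lA) sub0r.
  by rewrite !(linN lV) (linN laA) => ->; rewrite oppr0.
pose X1 := X0 \- (fun h => e%:C *: G (D h)).
have bX1 : bounded_op X1.
  apply: bop_sub => //; apply: bop_scale.
  exact: (bop_comp Hnorm bG bD).
have VX1 h : V (res X1 h) = V (res X0 h) - e%:C *: V (A (G h)).
  rewrite /X1 /= GD (linB lA) (linZ lA) !(linB lV) (linZ lV); vector_ring dot.
have c0 h : rdot (V (res X0 h)) (V (A (G h))) = nsq (G h).
  by rewrite -(pos_op_rsym _ _ pV) rdotC (rdot_adj Hnorm _ _ bA).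
have M1 h : nsq (V (A (G h))) <= k ^+ 2 * nsq (G h).
  by rewrite -!sqr_nm -exprMn ler_sqr ?nnegrE ?mulr_ge0 ?nm_ge0//; exact: hk.
have main h : nsq (V (res X1 h)) <= nsq (V (res X0 h)) - e * nsq (G h).
  rewrite VX1 nsqB nsqZ rdotZr c0.
  have h1 := ler_wpM2l (sqr_ge0 e) (M1 h).
  have h2 : e * (e * (k ^+ 2 + 1)) = e by rewrite /e mulVf ?mulr1// gt_eqF.
  have h3 : e ^+ 2 * (k ^+ 2 * nsq (G h)) <= e * nsq (G h).
    rewrite mulrA ler_wpM2r ?nsq_ge0// expr2 -mulrA -[leRHS]h2.
    by rewrite !ler_pM2l// lerDl.
  lra.
exists X1; split=> // [h|eq h].
  by apply: le_trans (main h) _; rewrite gerBl mulr_ge0 ?nsq_ge0// ltW.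
apply/eqP; rewrite -(nsq_eq0 dot); have := main h; rewrite eq => mh.
have : e * nsq (G h) <= 0 by lra.
by rewrite pmulr_rle0// => le0; rewrite -/(G h) eq_le le0 nsq_ge0.
Qed.

Lemma normal_eq_shorted W X0 : pos_op dot W -> (forall x, V (V x) = W x) -> bounded_op X0 ->
  (forall h, adj A (V (V (res X0 h))) = 0) ->
  forall h, nsq (op_sqrt dot (shorted dot W (range A)) (C h)) = nsq (V (res X0 h)).
Proof.
move=> pW VV bX0 ne h; have lA := bop_linear bA; have lV := bop_linear pV.1.
have bM : bounded_op (V \o A) by exact: (bop_comp Hnorm pV.1).
have sM := subspace_range (bop_linear bM).
have [P bP [cP oP]] := projection Hnorm sM.
have [pS SE] := shorted_proj Hnorm pW pV VV bA bP cP oP.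
have [pQ QQ] := op_sqrtP Hnorm pS.
rewrite /hnormsq -(pos_op_rsym _ _ pQ) QQ -/(nsq _) SE.
(* [V (C h)] splits as [V (A (X0 (B h)))], in the range of [V \o A], plus [- V (res X0 h)],
   orthogonal to that range by the normal equation. *)
have -> : V (C h) - P (V (C h)) = - V (res X0 h).
  apply: (proj_unique Hnorm (M := range (V \o A)) (m := V (A (X0 (B h)))) sM cP oP).
  - by apply: subset_closure; exists (X0 (B h)).
  - move=> u cu; rewrite dotC.
    rewrite (closure_dot Hnorm (T := id) (bop_id Hnorm) _ cu) ?rmorph0// => _ [a _ <-] /=.
    by rewrite linearNr/= (pos_op_sym _ _ pV) (dot_adj Hnorm _ _ bA) ne linear0r oppr0.
  - by rewrite /= (linB lV); vector_ring dot.
by rewrite nsqN.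
Qed.

End NormalEquation.

(** * Order and invariance of the Schatten norm *)

Section SchattenNorm.
Context {R : realType} {H : completeNormedModType R[i]}.
Variable dot : {dot H for Num.conj}.
Hypothesis Hnorm : hilbert_norm dot.
Local Notation nsq := (hnormsq dot).
Implicit Types (S T : H -> H) (p : R).

Local Open Scope ereal_scope.

Lemma schatten_sum_ge0 p T : 0 <= schatten_sum dot p T.
Proof.
apply: esum_ge0 => l _; rewrite mule_ge0 ?lee_fin ?powR_ge0//.
apply: ereal_sup_ubound; exists 0%N => //.
by exists (fun=> 0%R); split=> [c _ []|[]].
Qed.

(** Powers with positive exponent are monotone and invertible on [[0, +oo]], so norms compare
    exactly as sums do, infinite values included. *)
Lemma schatten_norm_le p S T : (0 < p)%R ->
  (schatten_norm dot p S <= schatten_norm dot p T) =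
  (schatten_sum dot p S <= schatten_sum dot p T).
Proof.
move=> p0; have ge0 := schatten_sum_ge0 p.
rewrite /schatten_norm; apply/idP/idP => h; last first.
  by apply: gt0_ler_poweR; rewrite ?invr_ge0 ?(ltW p0)// in_itv /= ge0 leey.
have E U : schatten_sum dot p U = (schatten_sum dot p U `^ p^-1) `^ p.
  by rewrite -poweRrM mulVf ?gt_eqF// poweRe1.
rewrite (E S) (E T); apply: gt0_ler_poweR => //; first exact: ltW.
  by rewrite in_itv /= poweR_ge0 leey.
by rewrite in_itv /= poweR_ge0 leey.
Qed.

Lemma schatten_norm_eq p S T : bounded_op S -> bounded_op T ->
  (forall x, nsq (S x) = nsq (T x)) -> schatten_norm dot p S = schatten_norm dot p T.
Proof.
by move=> bS bT h; rewrite /schatten_norm /schatten_sum /op_abs (adj_comp_eq Hnorm bS bT h).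
Qed.

End SchattenNorm.

(** * Equivalence of the conditions and description of the minimizers *)

Theorem theorem4p3 (R : realType) (H : completeNormedModType R[i])
    (dot : {dot H for Num.conj}) (Hnorm : hilbert_norm dot)
    (Hsep : exists2 D : set H, countable D & dense D)
    (A B C W : H -> H)
    (bA : bounded_op A) (clA : closed (range A))
    (bB : bounded_op B) (clB : closed (range B))
    (bC : bounded_op C) (posW : pos_op dot W)
    (p : R) (p1 : 1 <= p) (WSp : schatten_class dot p (op_sqrt dot W))
    (NB : nullspace B `<=` nullspace (adjoint dot A \o W \o C)) :
  let As := adjoint dot A in
  let AWA := As \o W \o A in
  let residual (X : H -> H) : H -> H := (A \o X \o B) \- C in
  let norm_pW (X : H -> H) : \bar R := wschatten_norm dot p W (residual X) in
  let qform (X : H -> H) : H -> H :=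
    adjoint dot (residual X) \o W \o residual X in
  let le_ereal (x y : \bar R) : Prop := (x <= y)%E in
  let short_norm : \bar R :=
    schatten_norm dot p (op_sqrt dot (shorted dot W (range A)) \o C) in
  let cond_i := exists X0 : H -> H, bounded_op X0 /\
    is_min le_ereal [set norm_pW X | X in bounded_op] (norm_pW X0) in
  let cond_ii := exists X : H -> H, bounded_op X /\
    forall h, (As \o W \o residual X) h = 0 in
  let cond_iii :=
    range C `<=` set_add (range A) (wperp dot W (range A)) in
  let cond_iv := exists X0 : H -> H, bounded_op X0 /\
    is_min (op_le dot) [set qform X | X in bounded_op] (qform X0) in
  [<-> cond_i; cond_ii; cond_iii; cond_iv] /\
  (cond_i ->
   [/\ is_min le_ereal [set norm_pW X | X in bounded_op] short_norm,
       (* the products (A^* W A)^dagger A^* W C B^dagger and B^dagger below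
          are everywhere defined *)
       (forall h, mp_dom dot B h /\
                  mp_dom dot AWA (As (W (C (mp_inv dot B h))))) &
       forall X0 : H -> H, bounded_op X0 ->
         (norm_pW X0 = short_norm <->
          exists L : H -> H, bounded_op L /\
            forall h, X0 h =
              mp_inv dot AWA (As (W (C (mp_inv dot B h)))) + L h
              - mp_inv dot AWA (AWA (L (B (mp_inv dot B h)))))]).

Proof.
move=> As AWA residual norm_pW qform le_ereal short_norm cond_i cond_ii cond_iii cond_iv.
have p0 : 0 < p by exact: lt_le_trans p1.
set V := op_sqrt dot W in WSp.
have [pV VV] : pos_op dot V /\ forall x, V (V x) = W x by exact: op_sqrtP.
have lV := bop_linear pV.1; have lA := bop_linear bA; have lB := bop_linear bB.
have lW := bop_linear posW.1; have bAs : bounded_op As by exact: bop_adj.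
have lAs := bop_linear bAs.
have bAWC : bounded_op (fun h => As (W (C h))).
  by have := bop_comp Hnorm bAs (bop_comp Hnorm posW.1 bC).
have lAWC := bop_linear bAWC.
have bAWA : bounded_op AWA.
  by have := bop_comp Hnorm bAs (bop_comp Hnorm posW.1 bA).
have lAWA := bop_linear bAWA.
have WE : W = V \o V by apply/funext => x /=.
have bres X : bounded_op X -> bounded_op (residual X).
  by move=> bX; apply: (bop_res Hnorm bA bB bC).
have cV : precompact_op dot V := schatten_precompact Hnorm WSp.
have cT X : bounded_op X -> precompact_op dot (V \o residual X).
  by move=> /bres; exact: (precompact_comp Hnorm cV).
pose NE X := forall h, As (V (V (residual X h))) = 0.
have NE_le X0 X : NE X0 -> forall h, hnormsq dot (V (residual X0 h)) <= hnormsq dot (V (residual X h)).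
  by move=> ne h; apply: (normal_eq_min Hnorm bA pV) => h'; exact: ne.
have norm_mono X0 X : bounded_op X0 -> bounded_op X ->
    (forall h, hnormsq dot (V (residual X0 h)) <= hnormsq dot (V (residual X h))) ->
    le_ereal (norm_pW X0) (norm_pW X).
  move=> b0 b h; rewrite /le_ereal /norm_pW /wschatten_norm schatten_norm_le//.
  by apply: (le_schatten_sum Hnorm p0 (cT _ b) (cT _ b0)).
have NB' : nullspace B `<=` nullspace (adjoint dot A \o (V \o V) \o C) by rewrite -WE.
have descent X0 : bounded_op X0 -> exists X1, [/\ bounded_op X1,
    forall h, hnormsq dot (V (residual X1 h)) <= hnormsq dot (V (residual X0 h)) &
    (forall h, hnormsq dot (V (residual X1 h)) = hnormsq dot (V (residual X0 h))) -> NE X0].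
  by move=> b0; exact: (normal_eq_descent Hnorm bA bB bC pV b0 clB NB').
(* The descent candidate has pointwise smaller residuals, while minimality gives the reverse
   inequality of finite Schatten sums; so the pointwise norms agree, which is the equality case of
   [descent]. *)
have min_NE X0 : bounded_op X0 ->
    (forall X, bounded_op X -> le_ereal (norm_pW X0) (norm_pW X)) -> NE X0.
  move=> b0 mn; have [X1 [b1 le1 eq1]] := descent _ b0; apply: eq1.
  apply: (schatten_sum_eq Hnorm p0 (cT _ b0) (cT _ b1) le1).
    exact: (schatten_sum_comp_fin Hnorm p0 cV (bres _ b0) WSp.2).
  by have := mn _ b1; rewrite /le_ereal /norm_pW /wschatten_norm schatten_norm_le.
have qpos X : bounded_op X -> pos_op dot (qform X).
  move=> /bres b; split.
    exact: (bop_comp Hnorm (bop_comp Hnorm (bop_adj Hnorm b) posW.1) b).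
  by move=> x; rewrite /qform /= (dot_adjl Hnorm _ _ b); exact: posW.2.
have qE X h : bounded_op X -> redot dot (qform X h) h = hnormsq dot (V (residual X h)).
  move=> /bres b; rewrite /qform rdotC -(rdot_adj Hnorm _ _ b) -VV.
  by rewrite -(pos_op_rsym _ _ pV).
have [D bD BDB] := closed_range_inner_inv Hnorm bB clB.
(* By the nullspace hypothesis [A^* W C h] depends only on [B h]. *)
have AWC_null n m : B n = B m -> As (W (C n)) = As (W (C m)).
  move=> e; apply/eqP; rewrite -subr_eq0 -(linB lAWC); apply/eqP.
  by apply: NB; rewrite /nullspace /= (linB lB) e subrr.
have AW0 v : wperp dot W (range A) v -> As (W v) = 0.
  move=> hv; apply: (@dot_injl _ _ dot) => a; rewrite dot0l (dot_adjl Hnorm _ _ bA).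
  by apply: hv; exists a.
have i_ii : cond_i -> cond_ii.
  move=> [X0 [b0 [_ mn]]]; exists X0; split=> // h; rewrite /= -VV.
  by apply: min_NE h => // X bX; apply: mn; exists X.
have ii_iii : cond_ii -> cond_iii.
  move=> [X [bX ne]] _ [h _ <-]; exists (A (X (B h))); first by exists (X (B h)).
  exists (C h - A (X (B h))); last by rewrite addrC subrK.
  move=> _ [a _ <-]; rewrite -(dot_adjl Hnorm _ _ bA) -/As.
  have -> : C h - A (X (B h)) = - residual X h by rewrite /residual /= opprB.
  by rewrite (linN lW) (linN lAs) [As _]ne oppr0 dot0l.
have AWC_AWA : cond_iii -> forall h, exists u, As (W (C h)) = AWA u.
  move=> iii h; have [_ [u _ <-] [v pv e]] := iii _ (imageP C (I : setT h)).
  by exists u; rewrite /= -e (linD lW) (linD lAs) (AW0 v pv) addr0.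
have iii_ii : cond_iii -> cond_ii.
  move=> iii; have [|bY YE] := bop_mp_inv Hnorm bAWA bAWC.
    by move=> _ [h _ <-]; have [u ->] := AWC_AWA iii h; exists u.
  (* The solution is [(A^* W A)^dagger A^* W C D], with the bounded inner inverse [D] of [B];
     [D (B h)] may replace [h] under [A^* W C]. *)
  eexists; split; first exact: (bop_comp Hnorm bY bD).
  move=> h; rewrite /residual /= (linB lW) (linB lAs).
  rewrite -[As (W (A _))]/(AWA _) YE; apply/eqP; rewrite subr_eq0; apply/eqP.
  by apply: AWC_null; rewrite BDB.
have ii_NE : cond_ii -> exists2 X0, bounded_op X0 & NE X0.
  by move=> [X [bX ne]]; exists X => // h; rewrite VV; exact: ne.
have iii_iv : cond_iii -> cond_iv.
  move=> /iii_ii/ii_NE[X0 b0 ne]; exists X0; split=> //; split; first by exists X0.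
  move=> _ [X bX <-]; apply/(op_le_rdot (qpos _ b0) (qpos _ bX)) => h.
  by rewrite !qE//; exact: NE_le.
have iv_i : cond_iv -> cond_i.
  move=> [X0 [b0 [_ mn]]]; exists X0; split=> //; split; first by exists X0.
  move=> _ [X bX <-]; apply: norm_mono => // h; rewrite -!qE//.
  have /(op_le_rdot (qpos _ b0) (qpos _ bX)) le := mn (qform X) (imageP qform bX).
  exact: le.
split; first by tfae.
move=> ci; have cii := i_ii ci; have ciii := ii_iii cii; have [Xn bn nen] := ii_NE cii.
(* Positivity of the shorted operator ensures that [op_sqrt] returns its square root and not the
   default value. *)
have pSh : pos_op dot (shorted dot W (range A)).
  have bM : bounded_op (V \o A) by exact: (bop_comp Hnorm pV.1).
  have [P bP [cP oP]] := projection Hnorm (subspace_range (bop_linear bM)).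
  by have [] := shorted_proj Hnorm posW pV VV bA bP cP oP.
have [pQ _] := op_sqrtP Hnorm pSh.
have shortE X0 : bounded_op X0 -> NE X0 -> norm_pW X0 = short_norm.
  move=> b0 ne; apply: (schatten_norm_eq Hnorm p).
  - exact: (bop_comp Hnorm pV.1 (bres _ b0)).
  - exact: (bop_comp Hnorm pQ.1 bC).
  - by move=> h; rewrite /= (normal_eq_shorted Hnorm bA pV posW VV b0 ne).
have short_le X : bounded_op X -> le_ereal short_norm (norm_pW X).
  by move=> bX; rewrite -(shortE _ bn nen); apply: norm_mono => //; exact: NE_le.
have BpB h : B (mp_inv dot B (B h)) = B h by exact: mp_invK.
split.
- split; first by exists Xn => //; exact: shortE.
  by move=> _ [X bX <-]; exact: short_le.
- move=> h; split; first exact: mp_dom_closed.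
  by have [u ->] := AWC_AWA ciii (mp_inv dot B h); exact: mp_dom_range.
move=> X0 b0; split=> [e|[L [bL LE]]].
  have ne : NE X0 by apply: min_NE => // X bX; rewrite e; exact: short_le.
  (* [L = X0] works: by the normal equation the first and last terms of the formula cancel. *)
  exists X0; split=> // h; set b := mp_inv dot B h.
  have -> : AWA (X0 (B b)) = As (W (C b)).
    apply/eqP; rewrite -subr_eq0; apply/eqP; rewrite -[RHS](ne b) VV.
    by rewrite /residual /AWA /= (linB lW) (linB lAs).
  by rewrite addrAC subrr add0r.
(* Under [A^* W A] the two terms in [L] cancel, since [B B^dagger B = B] and [AWA] composed with its
   generalized inverse fixes the range of [AWA]; what remains is [A^* W C h]. *)
apply: shortE => // h; rewrite VV /residual /= (linB lW) (linB lAs).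
rewrite -[As (W (A _))]/(AWA _) LE (linB lAWA) (linD lAWA).
have [u e] := AWC_AWA ciii (mp_inv dot B (B h)).
rewrite e !(mp_invK Hnorm _ bAWA) -e BpB addrK (AWC_null _ h) ?subrr//.
Qed.
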